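(* Consider the combinatorial Markovian bandit problem with $M$ users and $N\ge M$ resources, and the MLMR policy run with a sequence $L(\cdot)$, both described in the context. When using any arbitrarily slowly diverging non-decreasing sequence $L(n)$ of positive numbers (i.e., $L(n)\to\infty$ as $n\to\infty$) such that $L(n)\le n$ for all $n$, the expected regret $R(n)$ under the MLMR policy is at most $$\left[\frac{4M^3 N L(n)\ln n}{(\Delta_{\min})^2}+MN\,B_{\mathbf S,\mathbf P,\Theta}+M^2N\,\frac{s_{\max}}{\pi_{\min}}\left(1+\frac{\epsilon_{\max}}{10\,s_{\min}\theta_{\min}}\right)\frac{\pi}{3}\right]\Delta_{\max}+A_{\mathbf S,\mathbf P,\Theta},$$ where $B_{\mathbf S,\mathbf P,\Theta}$ is a constant that depends on $\theta_{\max}$, $s_{\max}$ and $\epsilon_{\min}$, and where in the factor $\pi/3$ the symbol $\pi$ (without indices) is the number $3.14159\ldots$.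
   Context: **Model.** There are $M$ users and $N\ge M$ resources; time is slotted, $n=1,2,\dots$. To each pair $(i,j)$, $1\le i\le M$, $1\le j\le N$, is associated an irreducible aperiodic Markov chain with finite state space $S_{i,j}$, transition matrix $\mathbf P_{i,j}$ and stationary distribution $(\pi^{i,j}_z)_{z\in S_{i,j}}$; these parameters are unknown to the users. The chains of different pairs are mutually independent. The chain of pair $(i,j)$ makes a transition only at those time slots in which resource $j$ is allocated to user $i$ (rested chains). When user $i$ is allocated resource $j$ and the chain is in state $z$, user $i$ observes and receives the reward $\theta^{i,j}_z$ (the values $\theta^{i,j}_z$ are also unknown). The mean reward is $\mu_{i,j}=\sum_{z\in S_{i,j}}\theta^{i,j}_z\pi^{i,j}_z$. **Arms and policies.** An arm $k$, $1\le k\le P(N,M)=N!/(N-M)!$, is a matching assigning distinct resources to all $M$ users, identified with its set $\mathcal A_k$ of $M$ pairs $(i,j)$. A policy $\alpha$ selects, at each time, an arm as a deterministic function of the past choices and of the past rewards observed for each played pair. Playing arm $k$ at time $n$ yields the rewards $Y_{i,j}(n)$ for all $(i,j)\in\mathcal A_k$, with $Y_{i,j}(n)=\theta^{i,j}_z$ for the current state $z$ of chain $(i,j)$, and total reward $\sum_{(i,j)\in\mathcal A_k}Y_{i,j}(n)$. Let $\mu^k=\sum_{(i,j)\in\mathcal A_k}\mu_{i,j}$ and $\mu^*=\max_k\mu^k$. Let $T_k^\alpha(n)$ be the number of times arm $k$ is played in the first $n$ slots under policy $\alpha$. **Regret.** $R^\alpha(n)=n\mu^*-E_\alpha\big[\sum_{t=1}^n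 Y_{\alpha(t)}(t)\big]$, where $Y_{\alpha(t)}(t)$ is the total reward at time $t$ of the arm chosen by $\alpha$. $R(n)$ denotes this quantity for the MLMR policy below. **MLMR policy with $L(n)$.** For every pair keep $n_{i,j}$, the number of times resource $j$ has been allocated to user $i$ so far, and $\hat\theta_{i,j}$, the sample mean of all rewards observed so far for the pair $(i,j)$; both are updated after each slot for all pairs of the played arm. Initialization: during the first $MN$ slots, for each pair $(p,q)$ in turn, one slot is spent playing any arm $k$ with $(p,q)\in\mathcal A_k$. Afterwards, at each time $n=MN+1,MN+2,\dots$, play an arm $k$ that maximizes $$\sum_{(i,j)\in\mathcal A_k}\left(\hat\theta_{i,j}+\sqrt{\frac{L(n)\ln n}{n_{i,j}}}\right),$$ where $\hat\theta_{i,j},n_{i,j}$ are the current values. **Constants.** $\Delta_k=\mu^*-\mu^k$; $\Delta_{\min}=\min_{k:\mu^k<\mu^*}\Delta_k$; $\Delta_{\max}=\max_k\Delta_k$; $\pi_{\min}=\min_{i,j,\,z\in S_{i,j}}\pi^{i,j}_z$; $s_{\max}=\max_{i,j}|S_{i,j}|$, $s_{\min}=\min_{i,j}|S_{i,j}|$; $\theta_{\max}=\max_{i,j,z}\theta^{i,j}_z$, $\theta_{\min}=\min_{i,j,z}\theta^{i,j}_z$; $\epsilon_{i,j}=1-\lambda_2$, where $\lambda_2$ is the second largest eigenvalue of $\mathbf P_{i,j}$; $\epsilon_{\max}=\max_{i,j}\epsilon_{i,j}$, $\epsilon_{\min}=\min_{i,j}\epsilon_{i,j}$. $A_{\mathbf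 S,\mathbf P,\Theta}$ is a constant, depending on all the state spaces $S_{i,j}$, transition matrices $\mathbf P_{i,j}$ and rewards $\theta^{i,j}_z$, such that $R^\alpha(n)\le\sum_{k=1}^{P(N,M)}(\mu^*-\mu^k)E_\alpha[T_k^\alpha(n)]+A_{\mathbf S,\mathbf P,\Theta}$ for policies $\alpha$ in this model.
   Formalization: All rewards are assumed positive (θ_min > 0): for θ_min = 0 the bound is undefined and for small negative θ_min it is false; the constant B may also depend on the fixed M, N and the sequence L(·). *)

(* Defs.v *)
From HB Require Import structures.
From mathcomp Require Import all_boot all_order all_algebra.
From mathcomp Require Import all_classical all_reals all_analysis.
From mathcomp Require Import complex.
Import Order.TTheory GRing.Theory Num.Theory.
Import numFieldNormedType.Exports.

Set Implicit Arguments.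
Unset Strict Implicit.
Unset Printing Implicit Defensive.

Local Open Scope classical_set_scope.
Local Open Scope ring_scope.

Definition is_distribution (R : realType) (s : nat) (p : 'rV[R]_s) : Prop :=
  (forall x, 0 <= p 0 x) /\ \sum_x p 0 x = 1.

Definition stochastic (R : realType) (s : nat) (P : 'M[R]_s) : Prop :=
  forall x, is_distribution (row x P).

Definition irreducible (R : realType) (s : nat) (P : 'M[R]_s) : Prop :=
  forall x y, exists n : nat, 0 < (P ^+ n) x y.

(* The possible return times to any state have no common divisor but 1.       *)
Definition aperiodic (R : realType) (s : nat) (P : 'M[R]_s) : Prop :=
  forall (x : 'I_s) (g : nat),
    (forall n : nat, (0 < n)%N -> 0 < (P ^+ n) x x -> (g %| n)%N) -> g = 1%N.

(* A finite chain with its rewards; the state space is encoded as 'I_nstates, *)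
(* which is nonempty since [stat] sums to 1.  The initial law is arbitrary.   *)
Record reward_chain (R : realType) := RewardChain {
  nstates : nat ;
  trans : 'M[R]_nstates ;
  stat : 'rV[R]_nstates ;
  init : 'rV[R]_nstates ;
  reward : 'I_nstates -> R ;
  trans_stochastic : stochastic trans ;
  trans_irreducible : irreducible trans ;
  trans_aperiodic : aperiodic trans ;
  stat_distribution : is_distribution stat ;
  stat_stationary : stat *m trans = stat ;
  init_distribution : is_distribution init
}.
Arguments reward {R} r _.

(* The complex eigenvalues, with multiplicity.                                *)
Definition spectrum (R : realType) (s : nat) (P : 'M[R]_s) :
    seq (complex R) :=
  sval (closed_field_poly_normal
          (char_poly (map_mx (real_complex R) P))).

(* P need not be reversible, so its eigenvalues are ordered by their real     *)
(* parts; this is the usual order whenever they are all real.  For a          *)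
(* one-state chain, which has no second eigenvalue, the value is 0.           *)
Definition second_eigenvalue (R : realType) (s : nat) (P : 'M[R]_s) : R :=
  (sort (fun x y : R => y <= x)
        [seq complex.Re z | z <- spectrum P])`_1.

Definition chain_mean (R : realType) (c : reward_chain R) : R :=
  \sum_z reward c z * stat c 0 z.

Definition eigengap (R : realType) (c : reward_chain R) : R :=
  1 - second_eigenvalue (trans c).

Definition arm (M N : nat) := {k : {ffun 'I_M -> 'I_N} | injectiveb k}.

(* The resource assigned to user i: A_k is the set of pairs (i, matched k i). *)
Definition matched (M N : nat) (k : arm M N) (i : 'I_M) : 'I_N := val k i.

Definition bandit (R : realType) (M N : nat) := 'I_M -> 'I_N -> reward_chain R.

(* [sup] and [inf] are used for maxima and minima of nonempty finite sets     *)
(* only, except that [Delta_min] is inf set0 = 0 if every arm is optimal.     *)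
Section Constants.
Context (R : realType) (M N : nat) (C : bandit R M N).

Definition arm_mean (k : arm M N) : R :=
  \sum_(i < M) chain_mean (C i (matched k i)).

Definition mu_star : R := sup [set arm_mean k | k in [set: arm M N]].

Definition Delta (k : arm M N) : R := mu_star - arm_mean k.

Definition Delta_min : R :=
  inf [set Delta k | k in [set k : arm M N | arm_mean k < mu_star]].

Definition Delta_max : R := sup [set Delta k | k in [set: arm M N]].

Definition pi_min : R := inf [set x | exists i j z, x = stat (C i j) 0 z].

Definition s_max : R := sup [set x | exists i j, x = (nstates (C i j))%:R].
Definition s_min : R := inf [set x | exists i j, x = (nstates (C i j))%:R].

Definition theta_max : R := sup [set x | exists i j z, x = reward (C i j) z].
Definition theta_min : R := inf [set x | exists i j z, x = reward (C i j) z].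

Definition eps_max : R := sup [set x | exists i j, x = eigengap (C i j)].
Definition eps_min : R := inf [set x | exists i j, x = eigengap (C i j)].

End Constants.

(* One slot is recorded as the arm played and the reward seen by each user;   *)
(* histories list the slots from the first to the last.                       *)
Definition slot (R : realType) (M N : nat) : Type :=
  (arm M N * {ffun 'I_M -> R})%type.

Definition history (R : realType) (M N : nat) : Type := seq (slot R M N).

Definition policy (R : realType) (M N : nat) : Type :=
  history R M N -> arm M N.

Definition nplays (R : realType) (M N : nat) (h : history R M N)
    (i : 'I_M) (j : 'I_N) : nat :=
  count (fun o : slot R M N => matched o.1 i == j) h.

Definition sample_mean (R : realType) (M N : nat) (h : history R M N)
    (i : 'I_M) (j : 'I_N) : R :=
  (\sum_(o <- h | matched o.1 i == j) o.2 i) / (nplays h i j)%:R.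

(* The quantity maximised in slot n = (size h).+1.                            *)
Definition mlmr_index (R : realType) (M N : nat) (L : nat -> R)
    (h : history R M N) (k : arm M N) : R :=
  let n := (size h).+1 in
  \sum_(i < M) (sample_mean h i (matched k i) +
    Num.sqrt (L n * ln (n%:R : R) / (nplays h i (matched k i))%:R)).

(* [pr] is the order in which the initialization visits the pairs; the arm    *)
(* containing the visited pair and the maximiser of the index are arbitrary.  *)
(* In the histories generated by [alpha], all the counters are positive from  *)
(* slot M * N + 1 on.                                                         *)
Definition mlmr (R : realType) (M N : nat) (L : nat -> R)
    (alpha : policy R M N) : Prop :=
  exists2 pr : 'I_(M * N) -> 'I_M * 'I_N, bijective pr &
    forall h : history R M N,
      (forall lt_h : (size h < M * N)%N,
         let p := pr (Ordinal lt_h) in matched (alpha h) p.1 = p.2) /\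
      ((M * N <= size h)%N ->
         forall k, mlmr_index L h k <= mlmr_index L h (alpha h)).

Section Process.
Context (d : measure_display) (T : measurableType d) (R : realType).
Context (Pr : probability T R) (M N : nat) (C : bandit R M N).
(* X i j m is the state of chain (i, j) after m transitions.                  *)
Context (X : forall i j, nat -> T -> 'I_(nstates (C i j))).

Definition trajectory i j (n : nat) (x : nat -> 'I_(nstates (C i j))) : set T :=
  [set w | forall m, (m <= n)%N -> X i j m w = x m].

(* Each X i j is a Markov chain with the prescribed parameters, and these     *)
(* chains are mutually independent.                                           *)
Definition bandit_process : Prop :=
  [/\ forall i j m z, measurable [set w | X i j m w = z],
      forall i j n x,
        Pr (@trajectory i j n x) =
        (init (C i j) 0 (x 0%N) *
           \prod_(m < n) trans (C i j) (x m) (x m.+1))%:E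
    & forall (J : {set 'I_M * 'I_N}) (n : nat)
             (x : forall i j, nat -> 'I_(nstates (C i j))),
        Pr [set w | forall i j, (i, j) \in J -> trajectory n (x i j) w] =
        (\prod_(p in J) Pr (trajectory n (x p.1 p.2)))%E].

(* The first n slots under [alpha].  The chains are rested: the number of     *)
(* transitions made by chain (i, j) is the number of earlier plays.           *)
Fixpoint run (alpha : policy R M N) (n : nat) (w : T) : history R M N :=
  if n is n'.+1 then
    let h := run alpha n' w in
    let k := alpha h in
    rcons h (k, [ffun i => let j := matched k i in
                           reward (C i j) (X i j (nplays h i j) w)])
  else [::].

Definition total_reward (alpha : policy R M N) (n : nat) (w : T) : R :=
  \sum_(o <- run alpha n w) \sum_(i < M) o.2 i.

Definition arm_plays (alpha : policy R M N) (k : arm M N) (n : nat) (w : T) :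
    nat :=
  count (fun o : slot R M N => o.1 == k) (run alpha n w).

(* The random variables below are bounded, so [fine] loses nothing.           *)
Definition regret (alpha : policy R M N) (n : nat) : R :=
  n%:R * mu_star C - fine ('E_Pr[total_reward alpha n])%E.

Definition regret_constant (A : R) : Prop :=
  forall (alpha : policy R M N) (n : nat), (0 < n)%N ->
    regret alpha n <=
    \sum_(k : arm M N)
      Delta C k * fine ('E_Pr[fun w => (arm_plays alpha k n w)%:R])%E + A.

End Process.

(* Main.v *)
Require Import Defs.
From mathcomp Require Import all_boot all_order all_algebra.
From mathcomp Require Import all_classical all_reals all_analysis.
From mathcomp Require Import measurable_realfun complex zify ring lra.
Import Order.TTheory GRing.Theory Num.Theory.
Import numFieldNormedType.Exports.
Local Open Scope classical_set_scope.
Local Open Scope ring_scope.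
Set Implicit Arguments.
Unset Strict Implicit.

(* Solving the Poisson equation reduces a chain to a martingale.  Removing    *)
(* the roots of the characteristic polynomial other than 1 one at a time,     *)
(* Cayley-Hamilton yields [f - mu = g - P g] with                             *)
(*   |g| <= G := s (1 + 2 / eps)^s |f|,                                       *)
(* reversible or not, so partial sums of rewards satisfy a Chernoff bound     *)
(* whose rate [1 / (32 G^2)] depends only on [theta_max], [s_max] and         *)
(* [eps_min].  As [L] diverges, [L t >= 96 G^2] from some [t0] on, and then   *)
(* a confidence bound fails in slot t with probability at most 4 / t^3 for    *)
(* each pair and each possible number of its plays; these failures, the       *)
(* initialization and the first t0 slots are absorbed in B.  In every other   *)
(* slot in which a suboptimal arm is played, some pair of that arm has been   *)
(* played fewer than [4 M^2 L(n) ln n / Delta_min^2] times, and each of the   *)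
(* M N pairs is responsible for at most that many slots, up to rounding.      *)

(** The argument has a probabilistic half and a deterministic half. For the first, [spectrum_split]
    isolates the eigenvalue 1 as a simple one, so that [poisson_equation] may divide by 1 - z for
    every other eigenvalue z; [path_mgf_from] telescopes the resulting coboundary along a path, and
    [chain_deviation] is the two-sided tail bound for one chain.

    The chains are rested, so by [sum_rewards] the sample mean of a pair after m plays is the mean
    over the first m states of its chain, whatever the policy did. The random number of plays
    therefore costs only a union bound over m ([deviation_prob], [deviation_sum_le]).

    The deterministic half is [suboptimal_cause]: once all pairs are initialized, a suboptimal arm
    with large counters can be chosen only if some confidence bound fails. [suboptimal_plays_le]
    counts slots by cause, and [expected_suboptimal_plays_le] weights them by the gaps and takes
    expectations. The slot from which the tail bounds apply depends on the bandit only through G,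
    which is why B can be chosen before the bandit. *)

(** * Spectrum of an irreducible stochastic matrix *)

Lemma mulmx_cV1E (F : pzSemiRingType) (s : nat) (P : 'M[F]_s) (w : 'cV[F]_s) x :
  (P *m w) x 0 = \sum_y P x y * w y 0.
Proof. by rewrite mxE. Qed.

(** Subtracting [c *m p] moves one eigenvalue 1 to 0. The bordered matrix [B] has the deflated
    characteristic matrix as its Schur complement; clearing its first column with a triangular
    matrix of determinant X - 1 leaves X times the original determinant. *)
Lemma char_poly_deflation (F : comNzRingType) (s : nat) (P : 'M[F]_s)
    (p : 'rV[F]_s) (c : 'cV[F]_s) :
  P *m c = c -> p *m c = 1%:M ->
  ('X - 1) * char_poly (P - c *m p) = 'X * char_poly P.
Proof.
move=> Pc pc; pose c' := map_mx (@polyC F) c; pose p' := map_mx (@polyC F) p.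
pose B : 'M[{poly F}]_(1 + s) := block_mx 1%:M (- p') c' (char_poly_mx P).
have detB : \det B = char_poly (P - c *m p).
  have -> : B = block_mx 1%:M 0 c' 1%:M *m
                block_mx 1%:M (- p') 0 (char_poly_mx (P - c *m p)).
    rewrite mulmx_block !mul1mx !mulmx1 !mul0mx !addr0 mulmxN; congr block_mx.
    by rewrite /char_poly_mx raddfB /= map_mxM opprB [X in _ = _ + X]addrCA addKr.
  by rewrite det_mulmx det_lblock det_ublock !det1 !mul1r.
have BM : B *m block_mx ('X - 1)%:M 0 (- c') 1%:M =
          block_mx 'X%:M (- p') 0 (char_poly_mx P).
  rewrite mulmx_block !mul1mx !mulmx1 !mulmx0 !add0r mulNmx !mulmxN opprK.
  congr block_mx.
    by rewrite /p' /c' -map_mxM pc map_mx1 /= raddfB /= subrK.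
  rewrite /char_poly_mx mulmxBl /c' -map_mxM Pc mul_scalar_mx mul_mx_scalar.
  by rewrite scalerBl scale1r subrr.
move/(congr1 determinant): BM.
rewrite det_mulmx detB det_lblock det_ublock. rewrite det1 !det_scalar1 mulr1.
by rewrite mulrC.
Qed.

Section Stochastic.
Context (R : realType) (s : nat) (P : 'M[R]_s).
Hypothesis P_sto : stochastic P.

Lemma stochastic_ge0 x y : 0 <= P x y.
Proof. by have [/(_ y)] := P_sto x; rewrite mxE. Qed.

Lemma stochastic_sum1 x : \sum_y P x y = 1.
Proof. by have [_ <-] := P_sto x; apply: eq_bigr => y _; rewrite mxE. Qed.

Lemma stochastic_mul1 : P *m const_mx 1 = const_mx 1 :> 'cV_s.
Proof.
apply/colP => x; rewrite !mxE -[RHS](stochastic_sum1 x).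
by apply: eq_bigr => y _; rewrite mxE mulr1.
Qed.

Lemma expmx_ge0 n x y : 0 <= (P ^+ n) x y.
Proof.
elim: n x y => [|n IHn] x y; first by rewrite expr0 mxE; case: eqP.
by rewrite exprS mxE sumr_ge0 // => z _; rewrite mulr_ge0 // stochastic_ge0.
Qed.

Lemma expmx_fixed (w : 'cV_s) n : P *m w = w -> P ^+ n *m w = w.
Proof.
by move=> Pw; elim: n => [|n IHn]; rewrite ?expr0 ?mul1mx // exprSr -mulmxA Pw.
Qed.

(** Maximum principle: at a maximizing state, every power of P averages [w] to its maximum, so the
    nonnegative deficits vanish wherever the power is positive; irreducibility reaches every state
    this way. *)
Lemma harmonic_const (w : 'cV_s) :
  irreducible P -> P *m w = w -> forall x y, w x 0 = w y 0.
Proof.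
move=> irr Pw x y.
pose xm := [arg max_(z > x) w z 0]%O.
have w_max z : w z 0 <= w xm 0.
  by rewrite /xm; case: arg_maxP => // i _; apply.
suff w_eq z : w z 0 = w xm 0 by rewrite !w_eq.
have [n Pn_gt0] := irr xm z.
have sum0 : \sum_u (P ^+ n) xm u * (w xm 0 - w u 0) = 0.
  under eq_bigr do rewrite mulrBr.
  rewrite sumrB -mulr_suml -mulmx_cV1E expmx_fixed //.
  have /colP/(_ xm) := expmx_fixed n stochastic_mul1.
  rewrite !mxE; under eq_bigr do rewrite mxE mulr1.
  by move=> ->; rewrite mul1r subrr.
have /eqP := @psumr_eq0P R _ _ _ (fun u _ =>
  mulr_ge0 (expmx_ge0 n xm u) (etrans (subr_ge0 _ _) (w_max u))) sum0 z isT.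
by rewrite mulf_eq0 gt_eqF //= subr_eq0 => /eqP.
Qed.

End Stochastic.

(** The unit disc touches the line of real part 1 only at 1. This turns modulus bounds into the
    order by real parts used in [second_eigenvalue]. *)
Lemma norm_le1_Re (R : realType) (z : R[i]) :
  `|z| <= 1 -> complex.Re z <= 1 /\ (complex.Re z = 1 -> z = 1).
Proof.
case: z => a b z_le1; have : `|a +i* b|%C ^+ 2 <= (1 : R)%:C%C.
  by rewrite exprn_ile1.
rewrite -add_Re2_Im2 lecR /= => ab; split; first by nra.
move=> a1; have /eqP : b ^+ 2 = 0 by apply/le_anti; rewrite sqr_ge0 andbT; nra.
by rewrite sqrf_eq0 a1 => /eqP ->.
Qed.

Lemma char_poly_trmx (F : comNzRingType) (s : nat) (A : 'M[F]_s) :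
  char_poly A^T = char_poly A.
Proof.
by rewrite /char_poly -det_tr /char_poly_mx linearB /= tr_scalar_mx map_trmx trmxK.
Qed.

Section Spectrum.
Context (R : realType) (s : nat) (P : 'M[R]_s) (p : 'rV[R]_s).
Hypotheses (P_sto : stochastic P) (P_irr : irreducible P).
Hypotheses (p_dist : is_distribution p) (p_stat : p *m P = p).

Let PC := map_mx (real_complex R) P.

Lemma distribution_mul1 : p *m const_mx 1 = 1%:M.
Proof.
have [_ p1] := p_dist; apply/rowP => i; rewrite ord1 !mxE -[RHS]p1.
by apply: eq_bigr => y _; rewrite mxE mulr1.
Qed.

(** Since rows sum to 1, P does not increase the l1 norm of a row vector, in particular of a left
    eigenvector. *)
Lemma stochastic_eigenvalue_le1 z : root (char_poly PC) z -> `|z| <= 1.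
Proof.
rewrite -eigenvalue_root_char => /eigenvalueP [v vP v_neq0].
have v_gt0 : 0 < \sum_y `|v 0 y|.
  rewrite lt_def sumr_ge0 // andbT; apply: contra_neq v_neq0 => /eqP.
  rewrite psumr_eq0 // => /allP v0; apply/rowP => y; rewrite mxE.
  by apply/eqP; rewrite -normr_eq0; apply: (implyP (v0 y _)); rewrite ?mem_index_enum.
rewrite -(ler_pM2r v_gt0) mul1r mulr_sumr.
have zv y : `|z| * `|v 0 y| = `|\sum_x v 0 x * (P x y)%:C%C|.
  rewrite -normrM; have /rowP/(_ y) := vP; rewrite !mxE => <-.
  by congr (`|_|); apply: eq_bigr => x _; rewrite mxE.
rewrite (eq_bigr _ (fun y _ => zv y)).
apply: le_trans (ler_sum _ (fun y _ => ler_norm_sum _ _ _)) _.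
rewrite exchange_big /= ler_sum // => x _.
under eq_bigr => y _ do
  rewrite normrM (ger0_norm (etrans (ler0c _) (stochastic_ge0 P_sto x y))).
by rewrite -mulr_sumr -rmorph_sum /= stochastic_sum1 // mulr1.
Qed.

(** Let w be a fixed column vector of the deflated matrix. Multiplying by p gives p w = 0, so P w =
    w, w is constant by [harmonic_const], and p w = 0 makes it zero. *)
Lemma deflation_1_notin_spectrum :
  ~~ root (char_poly (P - const_mx 1 *m p)) 1.
Proof.
(* [eigenvalue] concerns row vectors; transposing provides a column eigenvector. *)
rewrite -char_poly_trmx -eigenvalue_root_char; apply/negP.
move=> /eigenvalueP [v vA v_neq0]; pose w := v^T.
have Aw : P *m w - const_mx 1 *m (p *m w) = w.
  rewrite mulmxA -mulmxBl /w -[X in X *m _]trmxK -trmx_mul vA scale1r.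
  by [].
have pw0 : p *m w = 0.
  rewrite -[w in LHS]Aw mulmxBr [p *m (P *m w)]mulmxA p_stat [p *m (const_mx 1 *m _)]mulmxA.
  by rewrite distribution_mul1 mul1mx subrr.
move: Aw; rewrite pw0 mulmx0 subr0 => Pw.
case/eqP: v_neq0; apply/rowP => x; rewrite [RHS]mxE.
have [_ p1] := p_dist.
have /colP/(_ 0) := pw0; rewrite mxE [RHS]mxE => <-.
under eq_bigr do rewrite (harmonic_const P_sto P_irr Pw _ x).
by rewrite -mulr_suml p1 mul1r mxE.
Qed.

Lemma spectrum_prod : char_poly PC = \prod_(z <- spectrum P) ('X - z%:P).
Proof.
rewrite /spectrum; case: closed_field_poly_normal => r /= ->.
have /monicP -> := char_poly_monic PC.
by rewrite scale1r.
Qed.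

(** The eigenvalue 1 is simple and every other one has real part below 1, so 1 comes first in the
    sorted list and the next entry dominates the real parts of all the others. *)
Lemma spectrum_split : second_eigenvalue P < 1 /\
  exists2 r, perm_eq (spectrum P) (1 :: r) &
    forall z, z \in r -> complex.Re z <= second_eigenvalue P.
Proof.
have root_spectrum z : z \in spectrum P -> root (char_poly PC) z.
  by rewrite spectrum_prod root_prod_XsubC.
have one_in : 1 \in spectrum P.
  rewrite -root_prod_XsubC -spectrum_prod -map_char_poly.
  rewrite -(rmorph1 (real_complex R)) fmorph_root -eigenvalue_root_char.
  apply/eigenvalueP; exists p; rewrite ?scale1r //.
  apply/eqP => p0; have [_] := p_dist; rewrite p0.
  by under eq_bigr do rewrite mxE; rewrite big1 // => /eqP; rewrite eq_sym oner_eq0.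
pose r := rem 1 (spectrum P).
have perm_r : perm_eq (spectrum P) (1 :: r) := perm_to_rem one_in.
have r_neq1 : 1 \notin r.
  (* Cancelling X - 1 in the deflation identity shows that the deflated polynomial is X times the
     product over [r]; as 1 is not one of its roots, 1 is not in [r]. *)
  have := deflation_1_notin_spectrum.
  have := char_poly_deflation (stochastic_mul1 P_sto) distribution_mul1.
  move: (char_poly (_ - _)) => q Xq; rewrite -(fmorph_root (real_complex R)).
  move/(congr1 (map_poly (real_complex R))): Xq.
  rewrite !rmorphM rmorphB /= map_polyX rmorph1 map_char_poly /=.
  rewrite spectrum_prod (perm_big _ perm_r) big_cons /= mulrCA.
  move=> /mulfI -> //; last by rewrite -polyC1 polyXsubC_eq0.
  by rewrite rmorph1 rootM negb_or => /andP [_]; rewrite root_prod_XsubC.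
have r_lt1 z : z \in r -> complex.Re z < 1.
  move=> zr; have /norm_le1_Re [z_le1 z_eq1] : `|z| <= 1.
    apply: stochastic_eigenvalue_le1; apply: root_spectrum.
    by rewrite (perm_mem perm_r) inE zr orbT.
  rewrite lt_def z_le1 andbT eq_sym; apply: contra r_neq1 => /eqP/z_eq1 <- //.
pose leT := fun x y : R => y <= x.
have leT_total : total leT by move=> x y; rewrite /leT le_total.
have leT_trans : transitive leT by move=> y x z /= xy yz; apply: le_trans yz xy.
have leT_anti : antisymmetric leT by move=> x y; rewrite /leT andbC => /le_anti.
pose l := [seq complex.Re z | z <- r].
have sortE : sort leT (map (@complex.Re R) (spectrum P)) = 1 :: sort leT l.
  apply: (sorted_eq leT_trans leT_anti); first exact: sort_sorted.
    rewrite /= path_sortedE // sort_sorted // andbT all_sort.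
    by apply/allP => _ /mapP [u ur ->]; exact/ltW/r_lt1.
  rewrite perm_sort (perm_trans (perm_map _ perm_r)) //= perm_cons.
  by rewrite perm_sym perm_sort.
have l_lt1 x : x \in sort leT l -> x < 1.
  by rewrite mem_sort => /mapP [u ur ->]; apply: r_lt1.
rewrite /second_eigenvalue -/leT sortE /=; split.
  (* With a single state the list is exhausted and the default value 0 is still below 1. *)
  by case: (sort leT l) l_lt1 => [|a l'] l_lt1; rewrite ?ltr01 ?l_lt1 ?mem_head.
exists r => // z zr; have zl : complex.Re z \in sort leT l.
  by rewrite mem_sort; exact: map_f.
have := sort_sorted leT_total l.
case: (sort leT l) zl => //= a l'; rewrite inE => zl a_path.
case/orP: zl => [/eqP -> //|zl'].
by have /allP/(_ _ zl') := order_path_min leT_trans a_path.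
Qed.

End Spectrum.

(** * The Poisson equation *)

Lemma Re_sum (R : realType) (I : finType) (F : I -> R[i]) :
  complex.Re (\sum_i F i) = \sum_i complex.Re (F i).
Proof. by apply: (big_morph (@complex.Re R)) => // - [a b] [c d]. Qed.

Lemma Re_realM (R : realType) (x : R) (z : R[i]) :
  complex.Re (x%:C%C * z) = x * complex.Re z.
Proof. by case: z => a b /=; rewrite mul0r subr0. Qed.

Lemma Re_le_norm (R : realType) (z : R[i]) (x : R) :
  `|z| <= x%:C%C -> `|complex.Re z| <= x.
Proof.
case: z => a b; rewrite normc_def /= lecR => zx.
apply: le_trans zx; rewrite -sqrtr_sqr ler_wsqrtr //.
by rewrite lerDl sqr_ge0.
Qed.

Section Poisson.
Context (R : realType) (s : nat) (P : 'M[R]_s.+1) (p : 'rV[R]_s.+1).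
Hypotheses (P_sto : stochastic P) (P_irr : irreducible P).
Hypotheses (p_dist : is_distribution p) (p_stat : p *m P = p).

Let PC := map_mx (real_complex R) P.

Lemma stochastic_contraction (f : 'cV_s.+1) (F : R[i]) :
  (forall x, `|f x 0| <= F) -> forall x, `|(PC *m f) x 0| <= F.
Proof.
move=> fF x; rewrite mxE; apply: le_trans (ler_norm_sum _ _ _) _.
rewrite -[leRHS]mul1r -(rmorph1 (real_complex R)) -(stochastic_sum1 P_sto x).
rewrite rmorph_sum /= mulr_suml ler_sum // => y _; rewrite mxE normrM.
by rewrite ger0_norm ?ler0c ?stochastic_ge0 // ler_wpM2l // ler0c stochastic_ge0.
Qed.

(* If [f1 = (P - z) f / (1 - z)], then [f = f1 + (f - P f) / (1 - z)]; each   *)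
(* root [z] is thus removed at the cost of a coboundary.                      *)
Lemma coboundary_decomposition (r : seq R[i]) (rho F : R[i]) (f : 'cV_s.+1) :
  (forall z, z \in r -> [/\ z != 1, `|z| <= 1 & 2 / `|1 - z| <= rho]) ->
  1 <= rho -> (forall x, `|f x 0| <= F) ->
  exists (a : R[i]) (g : 'cV_s.+1),
    f = a *: (horner_mx PC (\prod_(z <- r) ('X - z%:P)) *m f) + (g - PC *m g)
    /\ forall x, `|g x 0| <= (size r)%:R * rho ^+ size r * F.
Proof.
move=> r_ok rho_ge1; elim: r r_ok f F => [|z r IHr] r_ok f F fF.
  exists 1, 0; rewrite big_nil rmorph1 mul1mx scale1r mulmx0 subr0 addr0.
  by split=> // x; rewrite mxE normr0 !mul0r.
have F_ge0 : 0 <= F by exact: le_trans (normr_ge0 _) (fF 0).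
have rho_ge0 : 0 <= rho by exact: le_trans ler01 rho_ge1.
have [z_neq1 z_le1 z_rho] := r_ok z (mem_head _ _).
have z1_neq0 : 1 - z != 0 by rewrite subr_eq0 eq_sym.
have z1_gt0 : 0 < `|1 - z| by rewrite normr_gt0.
pose f1 := (1 - z)^-1 *: ((PC - z%:M) *m f).
(* Both P f and z f are bounded by F, which explains the 2 in the assumption on [rho]. *)
have f1F x : `|f1 x 0| <= rho * F.
  rewrite /f1 mxE normrM normfV mulmxBl mul_scalar_mx.
  have -> : (PC *m f - z *: f) x 0 = (PC *m f) x 0 - z * f x 0 by rewrite !mxE.
  apply: (@le_trans _ _ (`|1 - z|^-1 * (F + F))).
    rewrite ler_wpM2l ?invr_ge0 //; apply: le_trans (ler_normB _ _) _.
    rewrite lerD ?stochastic_contraction // normrM.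
    by rewrite -[leRHS]mul1r ler_pM.
  by rewrite -mulr2n -[F *+ 2]mulr_natl mulrA [_^-1 * _]mulrC ler_wpM2r.
have r_ok' u : u \in r -> [/\ u != 1, `|u| <= 1 & 2 / `|1 - u| <= rho].
  by move=> ur; apply: r_ok; rewrite inE ur orbT.
have [a [g [f1E gF]]] := IHr r_ok' f1 _ f1F.
exists (a / (1 - z)), (g + (1 - z)^-1 *: f); split; last first.
  move=> x; rewrite mxE [X in _ + X]mxE.
  apply: le_trans (ler_normD _ _) _.
  rewrite /= exprSr mulrSr -mulrA -[_ * rho * F]mulrA mulrDl mul1r lerD //.
    by rewrite mulrA gF.
  rewrite normrM normfV.
  have z1_rho : `|1 - z|^-1 <= rho.
    by apply: le_trans z_rho; rewrite ler_pMl ?invr_gt0 // ler1n.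
  apply: (@le_trans _ _ (rho * F)); first by rewrite ler_pM ?invr_ge0.
  by rewrite -[leLHS]mul1r ler_wpM2r ?mulr_ge0 // exprn_ege1.
pose h := (1 - z)^-1 *: f.
have fE : f = f1 + (h - PC *m h).
  rewrite /f1 /h -scalemxAr -scalerBr -scalerDr mulmxBl mul_scalar_mx.
  rewrite addrCA [_ - _ - _]addrAC subrr add0r.
  have -> : f - z *: f = (1 - z) *: f by rewrite scalerBl scale1r.
  by rewrite scalerA mulVf // scale1r.
rewrite [LHS]fE {1}f1E big_cons [('X - _) * _]mulrC rmorphM rmorphB /= horner_mx_X horner_mx_C.
rewrite -mulmxE -mulmxA -scalerA -/h mulmxDr opprD [g + h + _]addrACA !addrA.
by rewrite /f1 -scalemxAr.
Qed.

(** Apply the decomposition to all eigenvalues but one copy of 1 and take real parts. What remains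
    of f is harmonic, hence constant, and must be the stationary mean. The ratio [rho] is admissible
    because |1 - z| >= 1 - Re z is at least the eigengap. *)
Lemma poisson_equation (f : 'I_s.+1 -> R) (F : R) :
  (forall x, `|f x| <= F) ->
  exists g : 'I_s.+1 -> R,
    (forall x, f x - \sum_z f z * p 0 z = g x - \sum_y P x y * g y) /\
    (forall x, `|g x| <= s%:R * (1 + 2 / (1 - second_eigenvalue P)) ^+ s * F).
Proof.
move=> fF; have [s2_lt1 [r perm_r r_le]] := spectrum_split P_sto P_irr p_dist p_stat.
have spec := spectrum_prod P; rewrite (perm_big _ perm_r) /= in spec.
have size_r : size r = s.
  have := size_char_poly PC; rewrite spec size_prod_XsubC /=.
  by move=> [].
pose fC : 'cV[R[i]]_s.+1 := \col_x (f x)%:C%C.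
have fCF x : `|fC x 0| <= F%:C%C.
  by rewrite mxE normc_def /= expr0n addr0 sqrtr_sqr lecR.
set rho := 1 + _.
have r_ok z : z \in r -> [/\ z != 1, `|z| <= 1 & 2 / `|1 - z| <= rho%:C%C].
  move=> zr; have z_le := r_le z zr.
  have z_neq1 : z != 1.
    by apply: contraTneq (le_lt_trans z_le s2_lt1) => ->; rewrite ltxx.
  split=> //; first apply: (stochastic_eigenvalue_le1 P_sto).
    by rewrite spec root_prod_XsubC inE zr orbT.
  have : `|complex.Re (1 - z)| <= complex.Re `|1 - z|.
    by apply: Re_le_norm; rewrite normc_def.
  have -> : complex.Re (1 - z) = 1 - complex.Re z by case: (z).
  rewrite ger0_norm; last by rewrite subr_ge0; lra.
  move=> z_norm.
  have -> : `|1 - z| = (complex.Re `|1 - z|)%:C%C by rewrite normc_def.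
  rewrite -(rmorph_nat (real_complex R)) -fmorphV -rmorphM lecR /rho.
  apply: ler_wpDl => //; rewrite ler_wpM2l // lef_pV2 ?posrE; lra.
have rho_ge1 : 1 <= rho%:C%C.
  rewrite -(rmorph1 (real_complex R)) lecR lerDl divr_ge0 //.
  by rewrite subr_ge0 ltW.
have [a [g [fCE gF]]] := coboundary_decomposition r_ok rho_ge1 fCF.
exists (fun x => complex.Re (g x 0)).
have gF' x : `|complex.Re (g x 0)| <= s%:R * rho ^+ s * F.
  apply: Re_le_norm; rewrite rmorphM /= rmorphM /= rmorphXn /= rmorph_nat.
  by have := gF x; rewrite size_r.
split=> // x.
pose b := a *: (horner_mx PC (\prod_(z <- r) ('X - z%:P)) *m fC).
(* P - 1 supplies the missing factor of the characteristic polynomial, so Cayley-Hamilton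
   annihilates (P - 1) b. *)
have Pb : PC *m b = b.
  apply/eqP; rewrite -subr_eq0 -{2}[b]mul1mx -mulmxBl /b -scalemxAr mulmxA.
  have -> : PC - 1%:M = horner_mx PC ('X - 1%:P).
    by rewrite rmorphB /= horner_mx_X horner_mx_C.
  rewrite mulmxE -rmorphM /= -{1}(big_cons _ _ _ _ xpredT (fun z => 'X - z%:P)).
  by rewrite -spec Cayley_Hamilton mul0mx scaler0.
rewrite -/b in fCE; move: b Pb fCE => b Pb fCE.
have fE y : f y = complex.Re (b y 0) +
    (complex.Re (g y 0) - \sum_z P y z * complex.Re (g z 0)).
  have Ref : (f y)%:C%C = b y 0 + (g y 0 - \sum_z (P y z)%:C%C * g z 0).
    have /colP/(_ y) := fCE; rewrite mxE [X in _ = X]mxE => ->; congr (_ + _).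
    by rewrite !mxE; congr (_ - _); apply: eq_bigr => z _; rewrite mxE.
  have -> : \sum_z P y z * complex.Re (g z 0) =
            complex.Re (\sum_z (P y z)%:C%C * g z 0).
    by rewrite Re_sum; apply: eq_bigr => z _; rewrite Re_realM.
  move/(congr1 (@complex.Re R)): Ref => /= ->.
  by case: (b y 0) (g y 0) (\sum_z _) => [? ?] [? ?] [? ?].
pose w : 'cV_s.+1 := \col_y complex.Re (b y 0).
have Pw : P *m w = w.
  apply/colP => y; rewrite !mxE -[in RHS]Pb mxE Re_sum.
  by apply: eq_bigr => z _; rewrite !mxE Re_realM.
have b_const y : complex.Re (b y 0) = complex.Re (b x 0).
  by have := harmonic_const P_sto P_irr Pw y x; rewrite !mxE.
(* The coboundary has mean zero under the stationary law, so only the constant survives averaging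
   against [p]. *)
suff -> : \sum_z f z * p 0 z = complex.Re (b x 0).
  by rewrite fE addrC addKr.
have [_ p1] := p_dist.
under eq_bigr do rewrite fE b_const mulrDl.
rewrite big_split /= -mulr_sumr p1 mulr1 -[RHS]addr0; congr (_ + _).
under eq_bigr do rewrite mulrBl.
rewrite sumrB; apply/eqP; rewrite subr_eq0; apply/eqP.
under [RHS]eq_bigr do rewrite mulr_suml.
rewrite exchange_big /=; apply: eq_bigr => z _.
have /rowP/(_ z) := p_stat; rewrite mxE => <-.
by rewrite mulr_sumr; apply: eq_bigr => y _; ring.
Qed.
End Poisson.

(** * Deviations of a Markov chain *)

Lemma big_cons_tuple (V : nmodType) (I : finType) (m : nat)
    (F : m.+1.-tuple I -> V) :
  \sum_c F c = \sum_x \sum_(c : m.-tuple I) F [tuple of x :: c].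
Proof.
rewrite pair_big /= (reindex (fun q : I * m.-tuple I => [tuple of q.1 :: q.2])) //=.
exists (fun c => (thead c, [tuple of behead c])) => [[x c] _|c _] /=.
  by congr (_, _); apply: val_inj.
by case/tupleP: c => x c; apply: val_inj; rewrite /= theadE.
Qed.

(** From exp(-x) >= 1 - x and (1 + x + 2 x^2)(1 - x) = 1 + x^2 (1 - 2 x) >= 1. *)
Lemma expR_le_quadratic (R : realType) (x : R) :
  x <= 1 / 2 -> expR x <= 1 + x + 2 * x ^+ 2.
Proof.
move=> x_le; rewrite -[x in expR x]opprK expRN.
have := expR_ge1Dx (- x); set e := expR _ => e_ge.
have e_gt0 : 0 < e by apply: expR_gt0.
rewrite -[leLHS]mul1r ler_pdivrMr //.
have : 0 <= 1 + x + 2 * x ^+ 2 by nra.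
have := sqr_ge0 x; nra.
Qed.

Section Paths.
Context (R : realType) (s : nat) (P : 'M[R]_s) (p0 : 'rV[R]_s).

Fixpoint path_weight (x : 'I_s) (c : seq 'I_s) : R :=
  if c is y :: c' then P x y * path_weight y c' else 1.

Definition path_law (c : seq 'I_s) : R :=
  if c is x :: c' then p0 0 x * path_weight x c' else 1.

Lemma path_weightE (z x : 'I_s) (c : seq 'I_s) :
  path_weight x c =
  \prod_(r < size c) P (nth z (x :: c) r) (nth z (x :: c) r.+1).
Proof.
elim: c x => [|y c IHc] x; first by rewrite big_ord0.
by rewrite big_ord_recl /= IHc.
Qed.

Hypotheses (P_sto : stochastic P) (p0_dist : is_distribution p0).

Lemma path_weight_ge0 x c : 0 <= path_weight x c.
Proof.
by elim: c x => //= y c IHc x; rewrite mulr_ge0 // stochastic_ge0.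
Qed.

Context (f g : 'I_s -> R) (G lambda : R).
Hypotheses (fg : forall x, f x = g x - \sum_y P x y * g y).
Hypotheses (gG : forall x, `|g x| <= G).
Hypotheses (lambda_ge0 : 0 <= lambda) (lambda_le : 4 * lambda * G <= 1).

Let sigma := 8 * lambda ^+ 2 * G ^+ 2.

Lemma mean_step_le x : `|\sum_y P x y * g y| <= G.
Proof.
apply: le_trans (ler_norm_sum _ _ _) _.
rewrite -[leRHS]mul1r -(stochastic_sum1 P_sto x) mulr_suml ler_sum // => y _.
by rewrite normrM ger0_norm ?stochastic_ge0 // ler_wpM2l ?stochastic_ge0.
Qed.

(** The increment [d] is centred and at most 2 lambda G <= 1/2 in modulus; in the quadratic bound
    the linear term averages out and 2 d^2 is at most [sigma]. *)
Lemma hoeffding_step x :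
  \sum_y P x y * expR (lambda * g y) <=
  expR (lambda * (\sum_y P x y * g y) + sigma).
Proof.
set m := \sum_y _ * g y; have m_le := mean_step_le x; rewrite -/m in m_le.
pose d y := lambda * (g y - m).
have d_le y : `|d y| <= 2 * lambda * G.
  rewrite /d normrM ger0_norm //.
  have : `|g y - m| <= 2 * G.
    by apply: le_trans (ler_normB _ _) _; have := gG y; lra.
  by move: lambda_ge0; nra.
have -> : \sum_y P x y * expR (lambda * g y) =
          expR (lambda * m) * \sum_y P x y * expR (d y).
  rewrite mulr_sumr; apply: eq_bigr => y _.
  by rewrite mulrCA -expRD /d; congr (_ * expR _); ring.
rewrite expRD ler_wpM2l ?expR_ge0 //; apply: le_trans (expR_ge1Dx _).
have -> : 1 + sigma = \sum_y P x y * (1 + d y + sigma).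
  under eq_bigr do rewrite mulrDr mulrDr mulr1 /d mulrCA mulrBr.
  rewrite !big_split /= -mulr_sumr sumrB -/m -!mulr_suml stochastic_sum1 //.
  by ring.
apply: ler_sum => y _; rewrite ler_wpM2l ?stochastic_ge0 //.
have /ler_normlP [d_ge d_le'] := d_le y.
apply: le_trans (expR_le_quadratic _) _; first by move: lambda_le; nra.
rewrite lerD2l /sigma.
have : d y ^+ 2 <= (2 * lambda * G) ^+ 2.
  by rewrite -[X in X <= _]real_normK ?num_real // lerXn2r ?nnegrE // (le_trans _ (d_le y)).
by rewrite !exprMn; lra.
Qed.

(** Because f(x) + (P g)(x) = g(x), the exponent telescopes backwards along the path, each
    transition costing one [sigma]. The term lambda G pays for the P g left over at the last
    state. *)
Lemma path_mgf_from x m :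
  expR (lambda * f x) *
    (\sum_(c : m.-tuple 'I_s)
       path_weight x c * expR (lambda * \sum_(y <- c) f y)) <=
  expR (lambda * g x + lambda * G + m.+1%:R * sigma).
Proof.
have sigma_ge0 : 0 <= sigma by apply: mulr_ge0; rewrite ?sqr_ge0 ?mulr_ge0 ?sqr_ge0.
have G_ge0 : 0 <= G by apply: le_trans (gG x); exact: normr_ge0.
elim: m x => [|m IHm] x.
  rewrite (big_pred1 [tuple]) => [|c]; last by rewrite [c]tuple0 /= eqxx.
  rewrite /= big_nil mulr0 expR0 !mulr1 ler_expR fg.
  have /ler_normlP [lo _] := mean_step_le x.
  by have := ler_wpM2l lambda_ge0 lo; lra.
rewrite big_cons_tuple /=.
apply: (@le_trans _ _ (expR (lambda * f x) *
    \sum_y P x y * (expR (lambda * g y) *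
      expR (lambda * G + m.+1%:R * sigma)))).
  rewrite ler_wpM2l ?expR_ge0 // ler_sum // => y _.
  rewrite -expRD addrA; apply: le_trans (ler_wpM2l _ (IHm y)); last first.
    exact: stochastic_ge0.
  rewrite !mulr_sumr ler_sum // => c _.
  by rewrite big_cons mulrDr expRD !mulrA [P x y * _ * _]mulrAC.
under eq_bigr do rewrite mulrA.
rewrite -mulr_suml mulrA.
apply: le_trans (ler_wpM2r (expR_ge0 _) (ler_wpM2l (expR_ge0 _) (hoeffding_step x))) _.
rewrite -!expRD ler_expR fg -[m.+2%:R]natr1 -[m.+1%:R]natr1. lra.
Qed.

(** Exponential Markov inequality; 2 lambda G covers the boundary values of the coboundary at both
    ends of the path. *)
Lemma path_law_upper_tail m a :
  \sum_(c : m.+1.-tuple 'I_s | a <= \sum_(y <- c) f y) path_law c <=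
  expR (2 * lambda * G + m.+1%:R * sigma - lambda * a).
Proof.
have [p0_ge0 p0_sum] := p0_dist.
apply: (@le_trans _ _ (\sum_(c : m.+1.-tuple 'I_s)
    path_law c * expR (lambda * \sum_(y <- c) f y - lambda * a))).
  rewrite [leRHS](bigID (fun c : m.+1.-tuple 'I_s => a <= \sum_(y <- c) f y)) /=.
  have law_ge0 (c : m.+1.-tuple 'I_s) : 0 <= path_law c.
    by case/tupleP: c => x c /=; rewrite mulr_ge0 ?path_weight_ge0.
  rewrite -[leLHS]addr0 lerD ?sumr_ge0 // => [|c _]; last first.
    by rewrite mulr_ge0 ?expR_ge0.
  rewrite ler_sum // => c ac; rewrite ler_peMr // -expR0 ler_expR.
  by rewrite subr_ge0 ler_wpM2l.
under eq_bigr do rewrite expRD mulrA.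
rewrite -mulr_suml expRD ler_wpM2r ?expR_ge0 // big_cons_tuple.
set E := leRHS; rewrite -[E]mul1r -p0_sum mulr_suml ler_sum // => x _.
apply: le_trans (ler_wpM2l (p0_ge0 x) (le_trans (path_mgf_from x m) _)).
  rewrite !mulr_sumr ler_sum // => c _ /=.
  by rewrite big_cons mulrDr expRD !mulrA [p0 0 x * _ * _]mulrAC.
rewrite /E ler_expR; have /ler_normlP [_ hi] := gG x; have := ler_wpM2l lambda_ge0 hi; lra.
Qed.

End Paths.

Lemma measurable_saturated (d : measure_display) (T : measurableType d)
    (U : finType) (phi : T -> U) (A : set T) :
  (forall u, measurable [set w | phi w = u]) ->
  (forall w w', phi w = phi w' -> A w -> A w') -> measurable A.
Proof.
move=> mphi A_sat.
have -> : A = \bigcup_(u in phi @` A) [set w | phi w = u].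
  apply/seteqP; split=> [w Aw|w [_ [w' Aw' <-] /= ww']]; first by exists (phi w) => //; exists w.
  by apply: A_sat Aw'.
by apply: fin_bigcup_measurable => //; exact: finite_finset.
Qed.

Lemma measure_bigsetU_le (d : measure_display) (T : measurableType d)
    (R : realType) (mu : {measure set T -> \bar R}) (I : Type) (r : seq I)
    (Q : pred I) (A : I -> set T) :
  (forall i, measurable (A i)) ->
  (mu (\big[setU/set0]_(i <- r | Q i) A i) <= \sum_(i <- r | Q i) mu (A i))%E.
Proof.
move=> mA; elim: r => [|i r IHr]; first by rewrite !big_nil measure0.
rewrite !big_cons; case: ifP => // _.
apply: le_trans (measureU2 _ (mA i) _) _; first exact: bigsetU_measurable.
exact: leeD2l.
Qed.

Section OneChain.
Context (d : measure_display) (T : measurableType d) (R : realType).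
Context (Pr : probability T R) (s : nat) (P : 'M[R]_s) (p0 : 'rV[R]_s).
Context (Y : nat -> T -> 'I_s).
Hypotheses (P_sto : stochastic P) (p0_dist : is_distribution p0).
Hypothesis mY : forall m z, measurable [set w | Y m w = z].
Hypothesis Y_law : forall n (x : nat -> 'I_s),
  Pr [set w | forall m, (m <= n)%N -> Y m w = x m] =
  (p0 0 (x 0%N) * \prod_(m < n) P (x m) (x m.+1))%:E.

Lemma measurable_path m (Q : pred (seq 'I_s)) :
  measurable [set w | Q [seq Y r w | r <- iota 0 m]].
Proof.
apply: (@measurable_saturated _ _ _ (fun w => [tuple Y r w | r < m])) => [c|w w' ww'].
  have -> : [set w | [tuple Y r w | r < m] = c] =
            \bigcap_(r in [set: 'I_m]) [set w | Y r w = tnth c r].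
    apply/seteqP; split=> [w /= <- r _|w Yc]; first by rewrite /= tnth_mktuple.
    by apply: eq_from_tnth => r; rewrite tnth_mktuple; exact: Yc.
  by apply: fin_bigcap_measurable => //; exact: finite_finset.
suff E v : [seq Y r v | r <- iota 0 m] = [tuple Y r v | r < m] by rewrite /= !E ww'.
by rewrite /= -val_enum_ord -map_comp.
Qed.

(** A path event is covered by cylinders, one per tuple. As [Y_law] takes infinite sequences, tuples
    are extended by their own first entry. *)
Lemma path_prob_le m (Q : pred (seq 'I_s)) :
  (Pr [set w | Q [seq Y r w | r <- iota 0 m.+1]] <=
   (\sum_(c : m.+1.-tuple 'I_s | Q c) path_law P p0 c)%:E)%E.
Proof.
pose A (c : m.+1.-tuple 'I_s) : set T :=
  [set w | forall r, (r <= m)%N -> Y r w = nth (thead c) c r].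
have mA c : measurable (A c).
  have -> : A c = \bigcap_(r in `I_m.+1) [set w | Y r w = nth (thead c) c r].
    by apply/seteqP; split=> w Aw r /=; apply: Aw.
  by apply: bigcap_measurable => //; exists 0%N.
apply: (@le_trans _ _ (Pr (\big[setU/set0]_(c : m.+1.-tuple 'I_s | Q c) A c))).
  apply: le_measure; rewrite ?inE.
  - exact: measurable_path.
  - exact: bigsetU_measurable.
  move=> w Qw; rewrite -bigcup_seq_cond.
  exists (map_tuple (Y^~ w) (iota_tuple m.+1 0)).
    by rewrite /= Qw mem_index_enum.
  move=> r r_le; rewrite (nth_map 0%N) ?size_iota ?ltnS //.
  by rewrite nth_iota.
apply: le_trans (measure_bigsetU_le _ _ _ mA) _.
rewrite -sumEFin lee_sum // => c _; rewrite [leLHS](Y_law m (nth (thead c) c)) lee_fin.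
case/tupleP: c => x c /=; rewrite theadE (path_weightE P x).
by rewrite size_tuple.
Qed.

(** The two tails are those of f - mu with solution g and of mu - f with solution - g. Each
    contributes a factor 2, an upper bound for the boundary cost exp(1/8). *)
Lemma chain_deviation (f g : 'I_s -> R) (mu theta G c : R) (m : nat) :
  (forall x, f x - mu = g x - \sum_y P x y * g y) ->
  (forall x, `|g x| <= G) -> (forall x, `|f x - mu| <= theta) ->
  0 < G -> theta <= G -> 0 <= c ->
  (Pr [set w | (m.+1%:R * c <= `|(\sum_(r < m.+1) f (Y r w)) - m.+1%:R * mu|)%R] <=
   (4 * expR (- (m.+1%:R * c ^+ 2 / (32 * G ^+ 2))))%:E)%E.
Proof.
move=> fg gG f_le G_gt0 theta_G c_ge0.
set n := m.+1; pose S w := (\sum_(r < n) f (Y r w)) - n%:R * mu.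
have n_gt0 : 0 < n%:R :> R by rewrite ltr0n.
have SE w : S w = \sum_(y <- [seq Y r w | r <- iota 0 n]) (f y - mu).
  rewrite big_map -{1}(subn0 n) -/(index_iota 0 n) big_mkord sumrB.
  by rewrite sumr_const card_ord /S mulr_natl.
(* A deviation above [theta] is impossible. Otherwise c <= G, which keeps lambda small enough for
   [hoeffding_step]. *)
have [c_le|c_gt] := leP c theta; last first.
  rewrite (_ : [set w | _] = set0) ?measure0 ?lee_fin ?mulr_ge0 ?expR_ge0 //.
  apply/seteqP; split=> // w /=; apply/negP; rewrite -ltNge -/(S w) SE.
  apply: le_lt_trans (ler_norm_sum _ _ _) _.
  apply: (@le_lt_trans _ _ (n%:R * theta)); last by rewrite ltr_pM2l.
  rewrite big_map -{1}(subn0 n) -/(index_iota 0 n) big_mkord mulr_natl.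
  by rewrite -[n in _ *+ n]card_ord -sumr_const ler_sum.
(* This minimizes 8 lambda^2 G^2 - lambda c, with value - c^2 / (32 G^2). *)
pose lambda := c / (16 * G ^+ 2).
have G2_gt0 : 0 < G ^+ 2 by rewrite exprn_gt0.
have lambda_ge0 : 0 <= lambda by rewrite divr_ge0 // mulr_ge0 // ltW.
have lambdaG : lambda * G = c / G / 16 by rewrite /lambda; field; rewrite gt_eqF.
have cG : c / G <= 1 by rewrite ler_pdivrMr // mul1r (le_trans c_le).
have lambda_le : 4 * lambda * G <= 1 by rewrite -mulrA lambdaG; lra.
have exp_le : expR (2 * lambda * G + n%:R * (8 * lambda ^+ 2 * G ^+ 2) -
    lambda * (n%:R * c)) <= 2 * expR (- (n%:R * c ^+ 2 / (32 * G ^+ 2))).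
  apply: (@le_trans _ _ (expR (1 / 8) * expR (- (n%:R * c ^+ 2 / (32 * G ^+ 2))))).
    rewrite -expRD ler_expR -addrA.
    have -> : n%:R * (8 * lambda ^+ 2 * G ^+ 2) - lambda * (n%:R * c) =
              - (n%:R * c ^+ 2 / (32 * G ^+ 2)).
      by rewrite /lambda; field; rewrite gt_eqF.
    by rewrite -[2 * _ * _]mulrA lambdaG; lra.
  rewrite ler_wpM2r ?expR_ge0 //.
  by apply: le_trans (expR_le_quadratic _) _; lra.
pose Q1 (l : seq 'I_s) := n%:R * c <= \sum_(y <- l) (f y - mu).
pose Q2 (l : seq 'I_s) := n%:R * c <= \sum_(y <- l) (mu - f y).
have -> : [set w | n%:R * c <= `|S w|] =
    [set w | Q1 [seq Y r w | r <- iota 0 n]] `|`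
    [set w | Q2 [seq Y r w | r <- iota 0 n]].
  have SE' w : - S w = \sum_(y <- [seq Y r w | r <- iota 0 n]) (mu - f y).
    by rewrite SE -sumrN; apply: eq_bigr => y _; rewrite opprB.
  apply/seteqP; split=> w /=; rewrite /Q1 /Q2 -SE -SE'.
    by rewrite ler_normr => /orP.
  by move=> S_ge; rewrite ler_normr; apply/orP.
apply: le_trans (measureU2 _ _ _) _; try exact: measurable_path.
have -> x : (4 * x)%:E = ((2 * x)%:E + (2 * x)%:E)%E :> \bar R.
  by rewrite -EFinD; congr EFin; ring.
apply: leeD; apply: le_trans (path_prob_le _ _) _; rewrite lee_fin.
  exact: le_trans (path_law_upper_tail P_sto p0_dist fg gG lambda_ge0 lambda_le _ _) exp_le.
have fg' x : mu - f x = - g x - \sum_y P x y * - g y.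
  rewrite -opprB fg opprB addrC; congr (_ + _).
  by rewrite -sumrN; apply: eq_bigr => y _; rewrite mulrN opprK.
have gG' x : `|- g x| <= G by rewrite normrN.
exact: le_trans (path_law_upper_tail P_sto p0_dist fg' gG' lambda_ge0 lambda_le _ _) exp_le.
Qed.
End OneChain.

(** * Constants of chains and bandits *)

Section FiniteBounds.
Context (R : realType) (A : set R).
Hypothesis finA : finite_set A.

Lemma finite_set_abs_bound : exists b : R, forall x, A x -> `|x| <= b.
Proof.
have [r ->] := (finite_seqP A).1 finA.
exists (\sum_(y <- r) `|y|) => x /= xr.
by rewrite (big_rem x) //= lerDl sumr_ge0.
Qed.

Lemma finite_le_sup x : A x -> x <= sup A.
Proof.
move=> Ax; apply: ub_le_sup => //; have [b bP] := finite_set_abs_bound.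
by exists b => y /bP; apply: le_trans; exact: ler_norm.
Qed.

Lemma finite_inf_le x : A x -> inf A <= x.
Proof.
move=> Ax; apply: ge_inf => //; have [b bP] := finite_set_abs_bound.
by exists (- b) => y /bP; rewrite lerNl; apply: le_trans; rewrite -normrN ler_norm.
Qed.

Lemma finite_inf_gt0 : A !=set0 -> (forall x, A x -> 0 < x) -> 0 < inf A.
Proof.
move=> A0 A_gt0; suff [b b_gt0 bP] : exists2 b : R, 0 < b & lbound A b.
  by apply: lt_le_trans b_gt0 _; exact: lb_le_inf.
have [r rE] := (finite_seqP A).1 finA; rewrite rE in A_gt0 *.
elim: {A0 rE} r A_gt0 => [|y r IHr] r_gt0; first by exists 1.
have [|b b_gt0 bP] := IHr; first by move=> x xr; apply: r_gt0; rewrite /= inE [x \in r]xr orbT.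
exists (Num.min y b); first by rewrite lt_min b_gt0 r_gt0 //= mem_head.
move=> x /=; rewrite inE => /orP [/eqP ->|xr]; first by rewrite ge_min lexx.
by rewrite ge_min bP ?orbT.
Qed.

End FiniteBounds.

Section ChainConstants.
Context (R : realType).

Lemma chain_gap_gt0 (c : reward_chain R) : 0 < eigengap c.
Proof.
have [gap _] := spectrum_split (@trans_stochastic _ c) (@trans_irreducible _ c)
  (@stat_distribution _ c) (stat_stationary c).
by rewrite subr_gt0.
Qed.

Lemma chain_poisson (c : reward_chain R) (F : R) :
  (forall z, `|reward c z| <= F) ->
  exists g : 'I_(nstates c) -> R,
    (forall x, reward c x - chain_mean c = g x - \sum_y trans c x y * g y) /\
    (forall x, `|g x| <= (nstates c)%:R * (1 + 2 / eigengap c) ^+ nstates c * F).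
Proof.
have := chain_gap_gt0 c; rewrite /eigengap /chain_mean.
case: c => [[|s] P p p0 f P_sto P_irr P_ap p_dist p_stat p0_dist] /= gap fF.
  by have [_] := p_dist; rewrite big_ord0 => /eqP; rewrite eq_sym oner_eq0.
have [g [gE gF]] := poisson_equation P_sto P_irr p_dist p_stat fF.
exists g; split=> // x; apply: le_trans (gF x) _.
have F_ge0 : 0 <= F by apply: le_trans (fF ord0).
have rho_ge1 : 1 <= 1 + 2 / (1 - second_eigenvalue P).
  by rewrite lerDl divr_ge0 // ltW.
have rho_ge0 := le_trans ler01 rho_ge1.
by rewrite ler_wpM2r // ler_pM ?exprn_ge0 ?ler_nat ?ler_weXn2l.
Qed.

(* The summand 1 only serves to make the bound at least [theta].              *)
Definition poisson_bound (theta s eps : R) : R :=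
  (1 + s * (1 + 2 / eps) ^+ Num.truncn s) * theta.

(** The bound is monotone in the three constants, so their extreme values over the pairs give one G
    for the whole bandit. *)
Lemma chain_poisson_bound (c : reward_chain R) (theta s eps : R) :
  (forall z, 0 < reward c z <= theta) -> (nstates c)%:R <= s ->
  0 < eps <= eigengap c ->
  exists g : 'I_(nstates c) -> R,
    (forall x, reward c x - chain_mean c = g x - \sum_y trans c x y * g y) /\
    (forall x, `|g x| <= poisson_bound theta s eps).
Proof.
move=> f_le s_ge /andP [eps_gt0 eps_le].
have f_abs z : `|reward c z| <= theta.
  by have /andP [f_gt0 ?] := f_le z; rewrite gtr0_norm.
have [g [gE gF]] := chain_poisson f_abs.
exists g; split=> // x; apply: le_trans (gF x) _.
have theta_ge0 : 0 <= theta by apply: le_trans (f_abs x).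
have gap_gt0 := chain_gap_gt0 c.
have s_ge0 : 0 <= s by apply: le_trans s_ge.
have rho_ge0 : 0 <= 2 / eigengap c by rewrite divr_ge0 // ltW.
have rho_le : 2 / eigengap c <= 2 / eps by rewrite ler_wpM2l // lef_pV2.
have rho_ge1 : 1 <= 1 + 2 / eps by lra.
rewrite /poisson_bound [leRHS]mulrDl [1 * theta]mul1r ler_wpDl // ler_wpM2r //.
rewrite ler_pM ?exprn_ge0 //; first lra.
apply: (@le_trans _ _ ((1 + 2 / eps) ^+ nstates c)).
  by rewrite lerXn2r ?nnegrE //; lra.
by rewrite ler_weXn2l // truncn_ge_nat.
Qed.

End ChainConstants.

Lemma finite_set_pairs (R : realType) (I J : finType) (f : I -> J -> R) :
  finite_set [set x | exists i j, x = f i j].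
Proof.
apply: (@sub_finite_set _ _ (range (fun p : I * J => f p.1 p.2))).
  by move=> _ [i [j ->]]; exists (i, j).
by apply: finite_image; exact: finite_finset.
Qed.

Lemma finite_set_triples (R : realType) (I J : finType) (n : I -> J -> nat)
    (f : forall i j, 'I_(n i j) -> R) :
  finite_set [set x | exists i j z, x = f i j z].
Proof.
pose U := {p : I * J & 'I_(n p.1 p.2)}.
apply: (@sub_finite_set _ _ (range (fun u : U => f _ _ (tagged u)))).
  move=> _ [i [j [z ->]]].
  by exists (Tagged (fun p : I * J => 'I_(n p.1 p.2)) (z : 'I_(n (i, j).1 (i, j).2))).
by apply: finite_image; exact: finite_finset.
Qed.

Section BanditConstants.
Context (R : realType) (M N : nat) (C : bandit R M N).
Hypotheses (M_gt0 : (0 < M)%N) (N_gt0 : (0 < N)%N).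

Let i0 := Ordinal M_gt0.
Let j0 := Ordinal N_gt0.

Lemma reward_bounds i j z : 0 < theta_min C ->
  0 < reward (C i j) z <= theta_max C.
Proof.
have fin := finite_set_triples (fun i j => reward (C i j)).
move=> theta_gt0; apply/andP; split.
  by apply: lt_le_trans theta_gt0 _; apply: finite_inf_le => //; exists i, j, z.
by apply: finite_le_sup => //; exists i, j, z.
Qed.

Lemma nstates_le_s_max i j : (nstates (C i j))%:R <= s_max C.
Proof.
apply: finite_le_sup; last by exists i, j.
exact: (finite_set_pairs (fun i j => (nstates (C i j))%:R)).
Qed.

Lemma s_min_ge0 : 0 <= s_min C.
Proof.
apply: lb_le_inf; first by exists (nstates (C i0 j0))%:R, i0, j0.
by move=> _ [i [j ->]].
Qed.

Lemma eps_min_gt0 : 0 < eps_min C.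
Proof.
apply: finite_inf_gt0; first exact: (finite_set_pairs (fun i j => eigengap (C i j))).
  by exists (eigengap (C i0 j0)), i0, j0.
by move=> _ [i [j ->]]; exact: chain_gap_gt0.
Qed.

Lemma eps_min_le i j : eps_min C <= eigengap (C i j).
Proof.
apply: finite_inf_le; last by exists i, j.
exact: (finite_set_pairs (fun i j => eigengap (C i j))).
Qed.

Lemma eps_max_ge0 : 0 <= eps_max C.
Proof.
apply: le_trans (ltW (chain_gap_gt0 (C i0 j0))) _.
apply: finite_le_sup; last by exists i0, j0.
exact: (finite_set_pairs (fun i j => eigengap (C i j))).
Qed.

Lemma pi_min_ge0 : 0 <= pi_min C.
Proof.
have [p_ge0 p_sum] := @stat_distribution _ (C i0 j0).
have [z _|no_state] := pickP 'I_(nstates (C i0 j0)).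
  apply: lb_le_inf; first by exists (stat (C i0 j0) 0 z), i0, j0, z.
  by move=> _ [i [j [u ->]]]; have [] := @stat_distribution _ (C i j).
by move: p_sum; rewrite big_pred0 // => /eqP; rewrite eq_sym oner_eq0.
Qed.

Lemma Delta_le_max (k : arm M N) : Delta C k <= Delta_max C.
Proof.
by apply: finite_le_sup; [apply: finite_image; exact: finite_finset | exists k].
Qed.

Lemma arm_mean_le (k : arm M N) : arm_mean C k <= mu_star C.
Proof.
by apply: finite_le_sup; [apply: finite_image; exact: finite_finset | exists k].
Qed.

Lemma Delta_ge0 (k : arm M N) : 0 <= Delta C k.
Proof. by rewrite subr_ge0 arm_mean_le. Qed.

Lemma best_arm (k : arm M N) : exists k', arm_mean C k' = mu_star C.
Proof.
exists [arg max_(k' > k) arm_mean C k']%O; apply/le_anti; rewrite arm_mean_le /=.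
apply: ge_sup; first by exists (arm_mean C k), k.
by move=> _ [k1 _ <-]; case: arg_maxP => // k2 _; apply.
Qed.

Lemma Delta_min_gt0 (k : arm M N) : arm_mean C k < mu_star C ->
  0 < Delta_min C <= Delta C k.
Proof.
move=> k_sub; have fin : finite_set [set Delta C k | k in
    [set k : arm M N | arm_mean C k < mu_star C]].
  by apply: finite_image; exact: finite_finset.
rewrite [X in _ && X]finite_inf_le //; last by exists k.
rewrite andbT; apply: finite_inf_gt0 => //; first by exists (Delta C k), k.
by move=> _ [k1 k1_sub <-]; rewrite subr_gt0.
Qed.

End BanditConstants.

(** * Runs of a policy *)

Lemma integral_weighted_indic (d : measure_display) (T : measurableType d)
    (R : realType) (Pr : probability T R) (I : finType) (a : I -> R)
    (A : I -> set T) :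
  (forall i, 0 <= a i) -> (forall i, measurable (A i)) ->
  (\int[Pr]_w (\sum_i a i * \1_(A i) w)%:E =
   (\sum_i a i * fine (Pr (A i)))%:E)%E.
Proof.
move=> a_ge0 mA; under eq_integral do rewrite -sumEFin.
rewrite ge0_integral_sum //; last 2 first.
- move=> i; apply/measurable_EFinP; apply: measurable_funM; first exact: measurable_cst.
  exact: measurable_indic.
- by move=> i w _; rewrite lee_fin mulr_ge0.
rewrite -sumEFin; apply: eq_bigr => i _.
under eq_integral do rewrite EFinM.
rewrite ge0_integralZl_EFin //; last first.
  by apply/measurable_EFinP; exact: measurable_indic.
rewrite integral_indic // setIT EFinM fineK //.
exact: fin_num_measure.
Qed.

(** Expectation of a pointwise inequality. The constant [K] is treated as the weight of the sure
    event, indexed by the summand ['I_1]. *)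
Lemma weighted_probability_le (d : measure_display) (T : measurableType d)
    (R : realType) (Pr : probability T R) (I J : finType) (a : I -> R)
    (b : J -> R) (A : I -> set T) (B : J -> set T) (K : R) :
  (forall i, 0 <= a i) -> (forall j, 0 <= b j) -> 0 <= K ->
  (forall i, measurable (A i)) -> (forall j, measurable (B j)) ->
  (forall w, \sum_i a i * \1_(A i) w <= K + \sum_j b j * \1_(B j) w) ->
  \sum_i a i * fine (Pr (A i)) <= K + \sum_j b j * fine (Pr (B j)).
Proof.
move=> a_ge0 b_ge0 K_ge0 mA mB AB; rewrite -lee_fin -integral_weighted_indic //.
pose b' (o : 'I_1 + J) := if o is inr j then b j else K.
pose B' (o : 'I_1 + J) := if o is inr j then B j else [set: T].
have b'_ge0 o : 0 <= b' o by case: o => [i|j] /=.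
have mB' o : measurable (B' o) by case: o => [i|j]; [exact: measurableT | exact: mB].
have -> : K + \sum_j b j * fine (Pr (B j)) = \sum_o b' o * fine (Pr (B' o)).
  by rewrite big_sumType big_ord1 /= probability_setT mulr1.
rewrite -integral_weighted_indic //; apply: ge0_le_integral => //.
- by move=> w _; rewrite lee_fin sumr_ge0 // => i _; rewrite mulr_ge0.
- apply/measurable_EFinP; apply: measurable_sum => i.
  by apply: measurable_funM; [exact: measurable_cst | exact: measurable_indic].
- apply/measurable_EFinP; apply: measurable_sum => i.
  by apply: measurable_funM; [exact: measurable_cst | exact: measurable_indic].
by move=> w _; rewrite lee_fin big_sumType big_ord1 /= indicT mulr1.
Qed.

Section Run.
Context (d : measure_display) (T : measurableType d) (R : realType).
Context (Pr : probability T R) (M N : nat) (C : bandit R M N).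
Context (X : forall i j, nat -> T -> 'I_(nstates (C i j))).
Context (alpha : policy R M N).
Hypothesis mX : forall i j m z, measurable [set w | X i j m w = z].

Lemma size_run t w : size (run X alpha t w) = t.
Proof. by elim: t => //= t IHt; rewrite size_rcons IHt. Qed.

Lemma nplays_run t w i j : (nplays (run X alpha t w) i j <= t)%N.
Proof. by rewrite -{2}(size_run t w) count_size. Qed.

Lemma nplays_runS t w i j :
  nplays (run X alpha t.+1 w) i j =
  (nplays (run X alpha t w) i j +
   (matched (alpha (run X alpha t w)) i == j))%N.
Proof. by rewrite /nplays /= -cats1 count_cat /= addn0. Qed.

Lemma nplays_run_mono t t' w i j : (t <= t')%N ->
  (nplays (run X alpha t w) i j <= nplays (run X alpha t' w) i j)%N.
Proof.
move=> /subnK <-; elim: (t' - t)%N => // r IHr.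
by rewrite addSn nplays_runS (leq_trans IHr) // leq_addr.
Qed.

Lemma run_determined t w w' :
  (forall i j m, (m < t)%N -> X i j m w = X i j m w') ->
  run X alpha t w = run X alpha t w'.
Proof.
elim: t => //= t IHt XX; rewrite IHt => [|i j m mt]; last by apply/XX/ltnW.
congr (rcons _ (_, _)); apply/ffunP => i; rewrite !ffunE; congr reward.
by apply: XX; rewrite ltnS nplays_run.
Qed.

(** The first t slots are a function of finitely many finite-valued states, so any set [Q] of
    histories will do. *)
Lemma measurable_run t (Q : set (history R M N)) :
  measurable [set w | Q (run X alpha t w)].
Proof.
pose phi w := [ffun p : 'I_M * 'I_N * 'I_t => X p.1.1 p.1.2 p.2 w]
  : {dffun forall p : 'I_M * 'I_N * 'I_t, 'I_(nstates (C p.1.1 p.1.2))}.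
apply: (@measurable_saturated _ _ _ phi) => [u|w w' ww' /=].
  have -> : [set w | phi w = u] = \bigcap_(p in [set: 'I_M * 'I_N * 'I_t])
      [set w | X p.1.1 p.1.2 p.2 w = u p].
    apply/seteqP; split=> [w /= <- p _ /=|w wu]; first by rewrite ffunE.
    by apply/ffunP => p; rewrite ffunE; exact: wu.
  by apply: fin_bigcap_measurable => //; exact: finite_finset.
rewrite (run_determined (w' := w')) // => i j m mt.
by have /ffunP/(_ (i, j, Ordinal mt)) := ww'; rewrite !ffunE.
Qed.

Lemma arm_plays_sum k n w :
  (arm_plays X alpha k n w)%:R =
  \sum_(t < n) \1_[set w' | alpha (run X alpha t w') = k] w :> R.
Proof.
elim: n => [|n IHn]; first by rewrite big_ord0.
rewrite big_ord_recr /= -IHn /arm_plays /= -cats1 count_cat /= addn0 natrD.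
congr (_ + _); rewrite indicE; congr (nat_of_bool _)%:R.
by apply/eqP/idP => [k_eq|/set_mem //]; exact/mem_set.
Qed.

Lemma expected_arm_plays k n :
  fine ('E_Pr[fun w => (arm_plays X alpha k n w)%:R])%E =
  \sum_(t < n) fine (Pr [set w | alpha (run X alpha t w) = k]).
Proof.
rewrite unlock; under eq_integral do rewrite arm_plays_sum.
under eq_integral do under eq_bigr do rewrite -[\1__ _]mul1r.
rewrite integral_weighted_indic // => [|t].
  by under eq_bigr do rewrite mul1r.
exact: (measurable_run t (fun h => alpha h = k)).
Qed.

(** A rested chain moves only when it is observed: the rewards seen on a pair are the successive
    values of its own chain, without gaps. *)
Lemma sum_rewards t w i j :
  \sum_(o <- run X alpha t w | matched o.1 i == j) o.2 i =
  \sum_(r < nplays (run X alpha t w) i j) reward (C i j) (X i j r w).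
Proof.
elim: t => [|t IHt]; first by rewrite big_nil big_ord0.
rewrite nplays_runS /= big_rcons /= IHt.
case: eqP => [<-|_]; last by rewrite addn0 addr0.
by rewrite addn1 big_ord_recr /= ffunE.
Qed.

(** Each counted slot raises the counter by one while it is below q; the sum is exactly the final
    counter truncated at q. *)
Lemma low_plays_le n q w i j :
  (\sum_(t < n) (let h := run X alpha t w in
     (matched (alpha h) i == j) && (nplays h i j < q)) <= q)%N.
Proof.
suff -> : (\sum_(t < n) (let h := run X alpha t w in
     (matched (alpha h) i == j) && (nplays h i j < q)) =
   minn (nplays (run X alpha n w) i j) q)%N by exact: geq_minr.
elim: n => [|n IHn]; first by rewrite big_ord0 min0n.
rewrite big_ord_recr IHn nplays_runS /=; set m := nplays _ i j.
by case: eqP => _ /=; case: ltnP => /=; lia.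
Qed.

End Run.

(** * Suboptimal plays of MLMR *)

Lemma sum_ltn n a : (\sum_(t < n) (t < a) = minn n a)%N.
Proof.
elim: n => [|n IHn]; first by rewrite big_ord0 min0n.
by rewrite big_ord_recr IHn /=; case: ltnP => /=; lia.
Qed.

Section MLMR.
Context (d : measure_display) (T : measurableType d) (R : realType).
Context (Pr : probability T R) (M N : nat) (C : bandit R M N).
Context (X : forall i j, nat -> T -> 'I_(nstates (C i j))).
Context (alpha : policy R M N) (L : nat -> R).
Hypotheses (M_gt0 : (0 < M)%N) (N_gt0 : (0 < N)%N).
Hypothesis L_gt0 : forall n, (0 < n)%N -> 0 < L n.
Hypothesis L_nondecreasing :
  forall m n, (0 < m)%N -> (m <= n)%N -> L m <= L n.
Hypothesis theta_gt0 : 0 < theta_min C.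
Hypothesis X_process : bandit_process Pr X.
Hypothesis alpha_mlmr : mlmr L alpha.

(** Failure in slot t + 1 of the confidence bound of a pair played m + 1 times, multiplied through
    by m + 1. *)
Definition deviation (i : 'I_M) (j : 'I_N) (m t : nat) : set T :=
  [set w | m.+1%:R * Num.sqrt (L t.+1 * ln (t.+1%:R : R) / m.+1%:R) <=
    `|\sum_(r < m.+1) reward (C i j) (X i j r w) -
      m.+1%:R * chain_mean (C i j)|].

Lemma measurable_deviation i j m t : measurable (deviation i j m t).
Proof.
have [mX _ _] := X_process.
pose Q (l : seq 'I_(nstates (C i j))) :=
  m.+1%:R * Num.sqrt (L t.+1 * ln (t.+1%:R : R) / m.+1%:R) <=
  `|\sum_(z <- l) reward (C i j) z - m.+1%:R * chain_mean (C i j)|.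
rewrite (_ : deviation i j m t = [set w | Q [seq X i j r w | r <- iota 0 m.+1]]).
  exact: (measurable_path (mX i j) m.+1 Q).
have E w : \sum_(z <- [seq X i j r w | r <- iota 0 m.+1]) reward (C i j) z =
           \sum_(r < m.+1) reward (C i j) (X i j r w).
  by rewrite big_map -{1}(subn0 m.+1) -/(index_iota 0 m.+1) big_mkord.
by apply/seteqP; split=> w; rewrite /deviation /Q /= E.
Qed.

Lemma theta_max_gt0 : 0 < theta_max C.
Proof.
have [p_ge0 p_sum] := @stat_distribution _ (C (Ordinal M_gt0) (Ordinal N_gt0)).
have [z _|no_state] := pickP 'I_(nstates (C (Ordinal M_gt0) (Ordinal N_gt0))).
  by have /andP [f_gt0] := reward_bounds z theta_gt0; apply: lt_le_trans.
by move: p_sum; rewrite big_pred0 // => /eqP; rewrite eq_sym oner_eq0.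
Qed.

Lemma reward_mean_dist i j z :
  `|reward (C i j) z - chain_mean (C i j)| <= theta_max C.
Proof.
have [p_ge0 p_sum] := @stat_distribution _ (C i j).
have mean_ge0 : 0 <= chain_mean (C i j).
  rewrite sumr_ge0 // => u _; rewrite mulr_ge0 //.
  by have /andP [/ltW] := reward_bounds u theta_gt0.
have mean_le : chain_mean (C i j) <= theta_max C.
  rewrite -[leRHS]mulr1 -p_sum mulr_sumr ler_sum // => u _.
  by rewrite ler_wpM2r //; have /andP [] := reward_bounds u theta_gt0.
have /andP [? ?] := reward_bounds z theta_gt0.
by rewrite ler_norml; apply/andP; split; lra.
Qed.

(** The number of plays cancels against the squared radius, leaving the exponent L ln(t+1) / (32
    G^2), which is at least 3 ln(t+1) since 96 = 3 * 32. *)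
Lemma deviation_prob i j m t :
  96 * poisson_bound (theta_max C) (s_max C) (eps_min C) ^+ 2 <= L t.+1 ->
  fine (Pr (deviation i j m t)) <= 4 / t.+1%:R ^+ 3.
Proof.
set G := poisson_bound _ _ _ => L_ge.
have [mX X_law _] := X_process.
have theta_G : theta_max C <= G.
  apply: ler_peMl; first exact: ltW theta_max_gt0.
  rewrite lerDl mulr_ge0 //; first exact: le_trans (nstates_le_s_max C i j).
  by rewrite exprn_ge0 // addr_ge0 // divr_ge0 // ltW // eps_min_gt0.
have G_gt0 : 0 < G := lt_le_trans theta_max_gt0 theta_G.
have [|||g [gE gG]] := @chain_poisson_bound _ (C i j) (theta_max C) (s_max C) (eps_min C).
- by move=> z; exact: reward_bounds.
- exact: nstates_le_s_max.
- by rewrite eps_min_gt0 //= eps_min_le.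
set c := Num.sqrt (L t.+1 * ln (t.+1%:R : R) / m.+1%:R).
have ln_ge0 : 0 <= ln (t.+1%:R : R) by rewrite ln_ge0 // ler1n.
have c2 : m.+1%:R * c ^+ 2 = L t.+1 * ln (t.+1%:R : R).
  rewrite sqr_sqrtr; first by rewrite mulrCA divff ?mulr1 // pnatr_eq0.
  by rewrite divr_ge0 // mulr_ge0 // ltW // L_gt0.
have := chain_deviation (@trans_stochastic _ (C i j)) (@init_distribution _ (C i j))
  (mX i j) (X_law i j) m gE gG (reward_mean_dist (j := j)) G_gt0 theta_G (sqrtr_ge0 _ : 0 <= c).
move=> dev_le.
have dev_fin : Pr (deviation i j m t) \is a fin_num.
  exact: fin_num_measure (measurable_deviation i j m t).
rewrite -lee_fin fineK //; apply: le_trans dev_le _.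
have G2_gt0 : 0 < 32 * G ^+ 2 by apply: mulr_gt0 => //; exact: exprn_gt0.
rewrite lee_fin c2 ler_wpM2l // expRN lef_pV2 ?posrE ?expR_gt0 ?exprn_gt0 //.
rewrite -[X in X ^+ 3]lnK ?posrE // -expRM_natl ler_expR -/G.
rewrite ler_pdivlMr //.
have : 0 <= (L t.+1 - 96 * G ^+ 2) * ln (t.+1%:R : R) by rewrite mulr_ge0 // subr_ge0.
lra.
Qed.

Lemma initialized t w i j : (M * N <= t)%N -> (0 < nplays (run X alpha t w) i j)%N.
Proof.
move=> t_ge; have [pr [pr' prK pr'K] mlmrP] := alpha_mlmr.
pose q := pr' (i, j).
apply: (@leq_trans (nplays (run X alpha q.+1 w) i j)); last first.
  by apply: nplays_run_mono; exact: leq_trans (ltn_ord q) t_ge.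
have lt_q : (size (run X alpha q w) < M * N)%N by rewrite size_run.
have [/(_ lt_q) /=] := mlmrP (run X alpha q w).
have -> : Ordinal lt_q = q by apply: val_inj; rewrite /= size_run.
rewrite pr'K /= nplays_runS => -> _.
by rewrite eqxx addn1.
Qed.

(** Without failures, the index of the played arm stays below its mean plus [Delta_min], hence below
    [mu_star], while the index of an optimal arm exceeds [mu_star]. This contradicts the maximality
    of the played arm. *)
Lemma suboptimal_cause n t w : (M * N <= t < n)%N ->
  arm_mean C (alpha (run X alpha t w)) < mu_star C ->
  (forall i, 4 * M%:R ^+ 2 * (L n * ln (n%:R : R)) / Delta_min C ^+ 2 <=
     (nplays (run X alpha t w) i (matched (alpha (run X alpha t w)) i))%:R) ->
  exists i j m, (m < t)%N /\ deviation i j m t w.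
Proof.
move=> /andP [t_ge t_lt]; set h := run X alpha t w; set k := alpha h.
move=> k_sub high; apply: contrapT => no_dev.
have [k' k'_best] := best_arm C k.
have /andP [Dmin_gt0 Dmin_le] := Delta_min_gt0 k_sub.
pose rad i j := Num.sqrt (L t.+1 * ln (t.+1%:R : R) / (nplays h i j)%:R).
have close i j : `|sample_mean h i j - chain_mean (C i j)| < rad i j.
  have := initialized w i j t_ge; rewrite -/h.
  case m_eq : (nplays h i j) => [//|m] _; rewrite ltNge; apply/negP => far.
  apply: no_dev; exists i, j, m; split.
    by rewrite -m_eq -(size_run X alpha t w) count_size.
  rewrite /deviation /=; move: far; rewrite /rad /sample_mean m_eq.
  rewrite sum_rewards -/h m_eq => far.
  have m_gt0 : 0 < m.+1%:R :> R by [].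
  rewrite -(ler_pM2l m_gt0) in far; apply: le_trans far _.
  set S := \sum_(r < _) _; set mu := chain_mean _.
  have -> : S - m.+1%:R * mu = m.+1%:R * (S / m.+1%:R - mu).
    by rewrite mulrBr mulrCA divff ?mulr1 // gt_eqF.
  by rewrite normrM gtr0_norm.
(* Each of the M pairs adds twice its radius to the index, hence half of [Delta_min / M].
   Monotonicity of [L] and [ln] lets the threshold at n serve slot t + 1. *)
have rad_le i : rad i (matched k i) <= Delta_min C / (2 * M%:R).
  have M_pos : 0 < M%:R :> R by rewrite ltr0n.
  have np_gt0 : 0 < (nplays h i (matched k i))%:R :> R.
    by rewrite ltr0n initialized.
  have y_ge0 : 0 <= Delta_min C / (2 * M%:R) by rewrite divr_ge0 ?mulr_ge0 // ltW.
  rewrite -[leRHS]ger0_norm // -sqrtr_sqr ler_wsqrtr // ler_pdivrMr //.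
  have Lln_le : L t.+1 * ln (t.+1%:R : R) <= L n * ln (n%:R : R).
    apply: ler_pM; [exact/ltW/L_gt0 | by rewrite ln_ge0 // ler1n | |].
      exact: L_nondecreasing.
    by rewrite ler_ln ?posrE ?ltr0n ?(leq_ltn_trans _ t_lt) // ler_nat.
  apply: le_trans Lln_le _; have := high i; rewrite -/h -/k.
  rewrite ler_pdivrMr ?exprn_gt0 // => high_i.
  rewrite expr_div_n mulrAC ler_pdivlMr ?exprn_gt0 ?mulr_gt0 //.
  by rewrite exprMn; move: high_i; lra.
have [_ _ /(_ h) [_]] := alpha_mlmr; rewrite {1}size_run => /(_ t_ge k').
rewrite -/k /mlmr_index size_run.
apply/negP; rewrite -ltNge.
have lt_sum (F1 F2 : 'I_M -> R) : (forall i, F1 i < F2 i) ->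
    \sum_i F1 i < \sum_i F2 i.
  move=> F12; apply: ltr_sum => //.
  by apply/hasP; exists (Ordinal M_gt0); rewrite ?mem_index_enum.
apply: (@lt_trans _ _ (\sum_(i < M) (chain_mean (C i (matched k i)) +
    Delta_min C / M%:R))).
  apply: lt_sum => i; have /ltr_normlP [_ up] := close i (matched k i).
  have := rad_le i; rewrite invfM mulrCA mulrA; move: up; rewrite -/(rad i (matched k i)).
  lra.
rewrite big_split /= -/(arm_mean C k) sumr_const card_ord -[_ *+ M]mulr_natr.
rewrite divfK ?pnatr_eq0 -?lt0n //.
have : mu_star C < \sum_(i < M) (sample_mean h i (matched k' i) + rad i (matched k' i)).
  rewrite -k'_best; apply: lt_sum => i.
  by have /ltr_normlP [lo _] := close i (matched k' i); lra.
apply: le_lt_trans; move: Dmin_le; rewrite /Delta; lra.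
Qed.

(** Each suboptimal slot is charged to the initialization, the first [T0] slots, a pair with a low
    counter, or a failure. The + 1 per pair rounds the threshold up to the integer [q]. *)
Lemma suboptimal_plays_le n w (T0 : nat) :
  \sum_(t < n) (arm_mean C (alpha (run X alpha t w)) < mu_star C)%R%:R <=
  (M * N + T0)%:R + (M * N)%:R *
    (4 * M%:R ^+ 2 * (L n * ln (n%:R : R)) / Delta_min C ^+ 2 + 1) +
  \sum_(t < n) \sum_(p : 'I_M * 'I_N) \sum_(m < n)
    ((T0 <= t) && (m < t))%N%:R * \1_(deviation p.1 p.2 m t) w :> R.
Proof.
(* The sign of [L 0] is not given, but [ln 0] is 0. *)
have [->|n_gt0] := posnP n.
  rewrite !big_ord0 addr0 addr_ge0 ?mulr_ge0 //.
  by rewrite ln0 // mulr0 mulr0 mul0r add0r.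
set l := _ / Delta_min C ^+ 2.
have l_ge0 : 0 <= l.
  by rewrite !mulr_ge0 ?invr_ge0 ?sqr_ge0 ?ln_ge0 ?ler1n // ltW // L_gt0.
pose q := (Num.truncn l).+1.
pose low t i j := let h := run X alpha t w in
  (matched (alpha h) i == j) && (nplays h i j < q)%N.
pose dev t : R := \sum_(p : 'I_M * 'I_N) \sum_(m < n)
    ((T0 <= t) && (m < t))%N%:R * \1_(deviation p.1 p.2 m t) w.
have dev_ge0 t : 0 <= dev t.
  by do 2!(rewrite sumr_ge0 // => ? _); rewrite mulr_ge0.
have step (t : 'I_n) :
    (arm_mean C (alpha (run X alpha t w)) < mu_star C)%R%:R <=
    ((t < M * N) + (t < T0) + \sum_i \sum_j low t i j)%N%:R + dev t.
  case: ltP => [k_sub|_] /=; last by rewrite addr_ge0.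
  have [|t_ge] := ltnP t (M * N).
    by move=> _; rewrite ler_wpDr // ler1n.
  have [|t_T0] := ltnP t T0.
    by move=> _; rewrite ler_wpDr // ler1n.
  pose k := alpha (run X alpha t w).
  have [/existsP [i i_low]|] := boolP [exists i, low t i (matched k i)].
    by rewrite ler_wpDr // ler1n (bigD1 i) //= (bigD1 (matched k i)) //= i_low.
  rewrite negb_exists => /forallP high.
  have [|||i [j [m [m_lt dev_m]]]] := @suboptimal_cause n t w.
  - by rewrite t_ge ltn_ord.
  - exact: k_sub.
  - move=> i; have := high i; rewrite /low eqxx /= -leqNgt /q => q_le.
    apply: le_trans (_ : (Num.truncn l).+1%:R <= _); last by rewrite ler_nat.
    by have /andP [_ /ltW] := truncn_itv l_ge0.
  have m_lt_n : (m < n)%N by apply: ltn_trans m_lt _.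
  rewrite ler_wpDl // /dev (bigD1 (i, j)) //= (bigD1 (Ordinal m_lt_n)) //=.
  rewrite t_T0 m_lt mul1r indicE mem_set // -addrA lerDl addr_ge0 //.
    by rewrite sumr_ge0 // => ? _; rewrite mulr_ge0.
  by do 2!(rewrite sumr_ge0 // => ? _); rewrite mulr_ge0.
apply: le_trans (ler_sum _ (fun t _ => step t)) _.
rewrite big_split /= lerD2r -natr_sum.
apply: (@le_trans _ _ (M * N + T0 + M * N * q)%N%:R); last first.
  rewrite natrD natrM lerD2l ler_wpM2l // /q -natr1 lerD2r.
  by rewrite truncn_le.
rewrite ler_nat !big_split /= leq_add ?leq_add ?sum_ltn ?geq_minr //.
rewrite exchange_big /= -[in X in (_ <= X)%N](card_ord M) -mulnA.
rewrite -sum_nat_const; apply: leq_sum => i _; rewrite exchange_big /=.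
rewrite -[in X in (_ <= X)%N](card_ord N) -sum_nat_const.
by apply: leq_sum => j _; exact: low_plays_le.
Qed.

(** Strengthened to 2 - 1/n for a sum of n >= 1 terms, the bound follows by induction. *)
Lemma sum_inv_sqr_le2 n : \sum_(t < n) (t.+1%:R ^+ 2)^-1 <= 2 :> R.
Proof.
suff : \sum_(t < n.+1) (t.+1%:R ^+ 2)^-1 <= 2 - n.+1%:R^-1 :> R.
  rewrite big_ord_recr /= => le2; apply: le_trans (le_trans _ le2) _.
    by rewrite lerDl invr_ge0 sqr_ge0.
  by rewrite lerBlDr lerDl invr_ge0.
elim: n => [|n IHn]; first by rewrite big_ord1 expr1n invr1; lra.
rewrite big_ord_recr /=; apply: le_trans (lerD IHn (lexx _)) _.
rewrite -[n.+2%:R]natr1; set x : R := n.+1%:R.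
have x_gt0 : 0 < x by rewrite ltr0n.
rewrite -subr_ge0.
have -> : 2 - (x + 1)^-1 - (2 - x^-1 + ((x + 1) ^+ 2)^-1) =
          (x * (x + 1) ^+ 2)^-1.
  by field; rewrite ?gt_eqF //; lra.
by rewrite invr_ge0 mulr_ge0 ?sqr_ge0 // ltW.
Qed.

(** In slot t + 1 there are at most t possible values of m, so each pair fails with total
    probability at most 4 / (t+1)^2, which sums to at most 8. *)
Lemma deviation_sum_le n (T0 : nat) :
  (forall t, (T0 <= t)%N ->
     96 * poisson_bound (theta_max C) (s_max C) (eps_min C) ^+ 2 <= L t.+1) ->
  \sum_(t < n) \sum_(p : 'I_M * 'I_N) \sum_(m < n)
    ((T0 <= t) && (m < t))%N%:R * fine (Pr (deviation p.1 p.2 m t)) <=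
  8 * (M * N)%:R.
Proof.
move=> L_ge.
apply: (@le_trans _ _ (\sum_(t < n) (M * N)%:R * 4 * (t.+1%:R ^+ 2)^-1)).
  apply: ler_sum => t _.
  apply: (@le_trans _ _ (\sum_(p : 'I_M * 'I_N) 4 * (t.+1%:R ^+ 2)^-1)); last first.
    by rewrite sumr_const card_prod !card_ord -[leLHS]mulr_natl mulrA.
  apply: ler_sum => p _.
  apply: (@le_trans _ _ (\sum_(m < n) (m < t)%N%:R * (4 / t.+1%:R ^+ 3))).
    apply: ler_sum => m _; case: (leqP T0 t) => t_T0 /=; last first.
      by rewrite mul0r mulr_ge0 // divr_ge0 // exprn_ge0.
    by rewrite ler_wpM2l // deviation_prob // L_ge.
  rewrite -mulr_suml -natr_sum.
  have t_gt0 : 0 < t.+1%:R :> R by [].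
  have -> : 4 * (t.+1%:R ^+ 2)^-1 = t.+1%:R * (4 / t.+1%:R ^+ 3) :> R.
    by field; rewrite gt_eqF.
  rewrite ler_wpM2r ?divr_ge0 ?exprn_ge0 // ler_nat.
  by rewrite sum_ltn geq_min leqnSn orbT.
rewrite -mulr_sumr; have := sum_inv_sqr_le2 n.
have : 0 <= (M * N)%:R :> R by []. nra.
Qed.

Lemma expected_suboptimal_plays_le n (T0 : nat) :
  (forall t, (T0 <= t)%N ->
     96 * poisson_bound (theta_max C) (s_max C) (eps_min C) ^+ 2 <= L t.+1) ->
  \sum_(k : arm M N) Delta C k *
    fine ('E_Pr[fun w => (arm_plays X alpha k n w)%:R])%E <=
  ((M * N + T0)%:R + (M * N)%:R *
    (4 * M%:R ^+ 2 * (L n * ln (n%:R : R)) / Delta_min C ^+ 2 + 1) +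
   8 * (M * N)%:R) * Delta_max C.
Proof.
move=> L_ge; have [mX _ _] := X_process.
have Dmax_ge0 : 0 <= Delta_max C.
  exact: le_trans (Delta_ge0 C (alpha [::])) (Delta_le_max C _).
set K := (M * N + T0)%:R + _.
have K_ge0 : 0 <= K.
  rewrite /K; have [->|n_gt0] := posnP n.
    by rewrite ln0 // mulr0 mulr0 mul0r add0r mulr1 addr_ge0.
  rewrite addr_ge0 // mulr_ge0 // addr_ge0 // !mulr_ge0 ?invr_ge0 ?sqr_ge0 //.
    by rewrite ltW // L_gt0.
  by rewrite ln_ge0 // ler1n.
pose b (x : 'I_n * ('I_M * 'I_N) * 'I_n) : R :=
  Delta_max C * ((T0 <= x.1.1) && (x.2 < x.1.1))%N%:R.
pose B (x : 'I_n * ('I_M * 'I_N) * 'I_n) :=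
  deviation x.1.2.1 x.1.2.2 x.2 x.1.1.
have flatten (F : nat -> 'I_M * 'I_N -> nat -> R) :
    \sum_(x : 'I_n * ('I_M * 'I_N) * 'I_n) b x * F x.1.1 x.1.2 x.2 =
    Delta_max C * \sum_(t < n) \sum_(p : 'I_M * 'I_N) \sum_(m < n)
      ((T0 <= t) && (m < t))%N%:R * F t p m.
  rewrite pair_bigA /= pair_bigA /= mulr_sumr; apply: eq_bigr => x _.
  by rewrite /b mulrA.
apply: (@le_trans _ _ (Delta_max C * K + \sum_x b x * fine (Pr (B x)))); last first.
  rewrite (flatten (fun t p m => fine (Pr (deviation p.1 p.2 m t)))) -mulrDr.
  rewrite mulrC ler_wpM2r // lerD2l; exact: deviation_sum_le.
under eq_bigr do rewrite expected_arm_plays // mulr_sumr.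
rewrite pair_bigA /=.
apply: (@weighted_probability_le _ _ _ Pr _ _
  (fun x : arm M N * 'I_n => Delta C x.1) b
  (fun x => [set w | alpha (run X alpha x.2 w) = x.1]) B (Delta_max C * K)).
- by move=> x; exact: Delta_ge0.
- by move=> x; rewrite mulr_ge0.
- by rewrite mulr_ge0.
- by move=> x; exact: (measurable_run alpha mX x.2 (fun h => alpha h = x.1)).
- by move=> x; exact: measurable_deviation.
move=> w; rewrite (flatten (fun t p m => \1_(deviation p.1 p.2 m t) w)) -mulrDr.
apply: le_trans (ler_wpM2l Dmax_ge0 (suboptimal_plays_le n w T0)).
rewrite mulr_sumr -(pair_bigA _ (fun (k : arm M N) (t : 'I_n) => Delta C k *
  \1_[set w | alpha (run X alpha t w) = k] w)) /= exchange_big /=.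
apply: ler_sum => t _; rewrite (bigD1 (alpha (run X alpha t w))) //= big1 ?addr0.
  rewrite indicE mem_set // mulr1; set k := alpha _.
  (* A suboptimal arm costs at most [Delta_max], an optimal one at most 0. *)
  case: ltP => [_|k_best]; first by rewrite mulr1 Delta_le_max.
  by rewrite mulr0 subr_le0.
move=> k /eqP k_neq; rewrite indicE memNset ?mulr0 //= => kE.
by apply: k_neq.
Qed.

End MLMR.

(** * The regret bound *)

Unset Implicit Arguments.

Theorem theorem2 (R : realType) (M N : nat) (L : nat -> R)
    (M_gt0 : (0 < M)%N) (le_MN : (M <= N)%N)
    (L_gt0 : forall n, (0 < n)%N -> 0 < L n)
    (L_nondecreasing : forall m n, (0 < m)%N -> (m <= n)%N -> L m <= L n)
    (L_diverges : L n @[n --> \oo] --> +oo)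
    (L_le : forall n, (0 < n)%N -> L n <= n%:R) :
  exists B : R -> R -> R -> R,
    forall (d : measure_display) (T : measurableType d) (Pr : probability T R)
           (C : bandit R M N) (X : forall i j, nat -> T -> 'I_(nstates (C i j)))
           (alpha : policy R M N) (A : R),
      0 < theta_min C ->
      bandit_process Pr X ->
      regret_constant Pr X A ->
      mlmr L alpha ->
      forall n, (0 < n)%N ->
        regret Pr X alpha n <=
        (4 * M%:R ^+ 3 * N%:R * L n * ln (n%:R : R) / Delta_min C ^+ 2
         + M%:R * N%:R * B (theta_max C) (s_max C) (eps_min C)
         + M%:R ^+ 2 * N%:R * (s_max C / pi_min C)
           * (1 + eps_max C / (10 * s_min C * theta_min C)) * (pi / 3))
        * Delta_max C + A.
Proof.
have N_gt0 : (0 < N)%N by exact: leq_trans le_MN.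
have L_large (a : R) : exists T0 : nat, forall t, (T0 <= t)%N -> a <= L t.+1.
  have /cvgryPge/(_ a) [T0 _ T0P] := L_diverges.
  by exists T0 => t T0_le; apply: T0P => /=; exact: leqW.
(* A choice function makes the starting slot depend on the threshold alone, so that [B] is a
   function of the three constants, fixed before the bandit. *)
have [T0 T0P] := choice L_large.
pose start theta s eps := T0 (96 * poisson_bound theta s eps ^+ 2).
(* Per pair, 10 = 1 + 1 + 8: initialization, rounding of the threshold, and failures. The starting
   slot is counted once and bounded by M N times itself. *)
exists (fun theta s eps => (start theta s eps)%:R + 10).
move=> d T Pr C X alpha A theta_gt0 X_process A_reg alpha_mlmr n n_gt0.
apply: le_trans (A_reg alpha n n_gt0) _; rewrite lerD2r.
set T1 := start _ _ _.
have := expected_suboptimal_plays_le M_gt0 N_gt0 L_gt0 L_nondecreasing theta_gt0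
  X_process alpha_mlmr n (T0P _ : forall t, (T1 <= t)%N -> _).
move=> /le_trans; apply; apply: ler_wpM2r.
  exact: le_trans (Delta_ge0 C (alpha [::])) (Delta_le_max C _).
apply: ler_wpDr.
  have i0 := Ordinal M_gt0; have j0 := Ordinal N_gt0.
  have s_ge0 : 0 <= s_max C by apply: le_trans (nstates_le_s_max C i0 j0).
  have pi0 := pi_ge0 R.
  rewrite !mulr_ge0 ?exprn_ge0 ?invr_ge0 ?(pi_min_ge0 C M_gt0 N_gt0) //.
  by rewrite addr_ge0 // divr_ge0 ?(eps_max_ge0 C M_gt0 N_gt0) // !mulr_ge0
    ?(s_min_ge0 C M_gt0 N_gt0) // ltW.
have MN_ge1 : 1 <= (M * N)%:R :> R by rewrite ler1n muln_gt0 M_gt0.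
have T1_le : T1%:R <= (M * N)%:R * T1%:R :> R by rewrite ler_peMl.
rewrite natrD; move: T1_le; rewrite natrM.
set D := Delta_min C ^+ 2; lra.
Qed.
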